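(* Let $K\subset\mathbb{R}^n$ ($n\ge 2$) be a compact set. For all $z\in K$, the harmonic measure $\omega_K(z,\cdot)$ is maximal in $\mathcal{J}(K)$.
   Context: Jensen measures: for an open set $U$ and $z\in U$, $\mathcal{J}_z(U)$ is the set of Radon probability measures $\mu$ with support compactly contained in $U$ such that $f(z)\le\int f\,d\mu$ for every subharmonic function $f$ on $U$. For $z\in K$, $\mathcal{J}_z(K)=\bigcap_{U\supset K}\mathcal{J}_z(U)$ over all open $U\supset K$, and $\mathcal{J}(K)=\bigcup_{z\in K}\mathcal{J}_z(K)$. $S(K)$ is the uniform closure in $C(K)$ of the set of functions in $C(K)$ that are restrictions to $K$ of functions subharmonic on a neighborhood of $K$. Ordering: for $\mu,\nu\in\mathcal{J}(K)$, $\mu\succeq\nu$ means $\int\phi\,d\mu\ge\int\phi\,d\nu$ for every $\phi\in S(K)$. A measure $\mu\in\mathcal{J}(K)$ is maximal if there is no $\nu\in\mathcal{J}(K)$ with $\nu\succeq\mu$ and $\nu\ne\mu$. Harmonic measure on $K$: a bounded open set $U$ is regular if for every $f\in C(\partial U)$ there is $h_f\in C(\overline U)$ harmonic on $U$ with $h_f=f$ on $\partial U$; for $z\in U$, $\omega_U(z,\cdot)$ is the Radon probability measure on $\partial U$ with $h_f(z)=\int_{\partial U} f\,d\omega_U(z,\cdot)$ for all $f\in C(\partial U)$. A sequence $\{U_j\}$ of regular open sets containing $K$ with $\overline{U}_{j+1}\subset U_j$ for all $j$ converges to $K$ if for every $\varepsilon>0$ there is $j_0$ such that $U_j$ lies in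 the $\varepsilon$-neighborhood of $K$ for $j\ge j_0$. Such sequences exist. For $z\in K$, $\omega_K(z,\cdot)$ is the weak$^*$ limit of $\omega_{U_j}(z,\cdot)$; the limit exists and does not depend on the choice of the sequence. *)

(* Defs.v *)
From HB Require Import structures.
From mathcomp Require Import all_boot all_order all_algebra.
From mathcomp Require Import all_classical all_reals all_analysis.

Set Implicit Arguments.
Unset Strict Implicit.
Unset Printing Implicit Defensive.

Import Order.TTheory GRing.Theory Num.Theory.
Import numFieldNormedType.Exports.

Local Open Scope classical_set_scope.
Local Open Scope ring_scope.

(* R^n is 'rV[R]_n. Its library topology comes from the sup norm and is the
   usual one, but the library's `|x| and ball are not Euclidean. *)

Definition enorm (R : realType) (n : nat) (x : 'rV[R]_n) : R :=
  Num.sqrt (\sum_(i < n) x ord0 i ^+ 2).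

Definition eball (R : realType) (n : nat) (c : 'rV[R]_n) (r : R)
    : set 'rV[R]_n :=
  [set x | enorm (x - c) < r].

Definition ecball (R : realType) (n : nat) (c : 'rV[R]_n) (r : R)
    : set 'rV[R]_n :=
  [set x | enorm (x - c) <= r].

Definition esphere (R : realType) (n : nat) (c : 'rV[R]_n) (r : R)
    : set 'rV[R]_n :=
  [set x | enorm (x - c) = r].

Definition bdry (T : topologicalType) (A : set T) : set T :=
  closure A `\` interior A.

Definition basis_vec (R : realType) (n : nat) (i : 'I_n) : 'rV[R]_n :=
  delta_mx ord0 i.

Definition partial (R : realType) (n : nat) (i : 'I_n) (f : 'rV[R]_n -> R)
    : 'rV[R]_n -> R :=
  fun x => 'D_(basis_vec R i) f x.

Definition C2_on (R : realType) (n : nat) (U : set 'rV[R]_n)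
    (f : 'rV[R]_n -> R) : Prop :=
  forall x, U x ->
    [/\ {for x, continuous f},
        forall i : 'I_n, derivable f x (basis_vec R i) /\
          {for x, continuous (partial i f)}
      & forall i j : 'I_n, derivable (partial i f) x (basis_vec R j) /\
          {for x, continuous (partial j (partial i f))}].

Definition laplacian (R : realType) (n : nat) (f : 'rV[R]_n -> R)
    (x : 'rV[R]_n) : R :=
  \sum_(i < n) partial i (partial i f) x.

(* Only used for open U; the values of h outside U are irrelevant. *)
Definition harmonic_on (R : realType) (n : nat) (U : set 'rV[R]_n)
    (h : 'rV[R]_n -> R) : Prop :=
  C2_on U h /\ forall x, U x -> laplacian h x = 0.

(* Only used for open U; the values of u outside U are irrelevant. *)
Definition usc_on (R : realType) (n : nat) (U : set 'rV[R]_n)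
    (u : 'rV[R]_n -> \bar R) : Prop :=
  forall x, U x -> forall a : R, (u x < a%:E)%E ->
    \forall y \near x, (u y < a%:E)%E.

(* Upper semicontinuous with values in [-oo, +oo), and below every harmonic
   majorant on balls; u = -oo identically on a component is allowed. *)
Definition subharmonic (R : realType) (n : nat) (U : set 'rV[R]_n)
    (u : 'rV[R]_n -> \bar R) : Prop :=
  [/\ forall x, U x -> (u x < +oo)%E,
      usc_on U u
    & forall (c : 'rV[R]_n) (r : R), 0 < r -> ecball c r `<=` U ->
      forall h : 'rV[R]_n -> R,
        {within ecball c r, continuous h} ->
        harmonic_on (eball c r) h ->
        (forall y, esphere c r y -> (u y <= (h y)%:E)%E) ->
        forall y, ecball c r y -> (u y <= (h y)%:E)%E].

(* R^n with its Borel sigma-algebra. Every Borel probability measure on R^n is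
   Radon, and Radon probability measures on a subset are identified with Borel
   probability measures on R^n carried by that subset. *)
Notation borelRn R n := (g_sigma_algebraType (@open 'rV[R]_n)).

Definition msupport (R : realType) (n : nat)
    (mu : probability (borelRn R n) R) : set 'rV[R]_n :=
  [set x | forall V : set 'rV[R]_n, open V -> V x -> (0 < mu V)%E].

(* A measure is also a function on the non-Borel sets, hence not Leibniz
   equality. *)
Definition meas_eq (R : realType) (n : nat)
    (mu nu : probability (borelRn R n) R) : Prop :=
  forall A : set (borelRn R n), measurable A -> mu A = nu A.

Definition jensen_open (R : realType) (n : nat) (U : set 'rV[R]_n)
    (z : 'rV[R]_n) (mu : probability (borelRn R n) R) : Prop :=
  [/\ compact (msupport mu), msupport mu `<=` U
    & forall f : 'rV[R]_n -> \bar R, subharmonic U f ->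
      (f z <= \int[mu]_(x in U) f x)%E].

Definition jensen_at (R : realType) (n : nat) (K : set 'rV[R]_n)
    (z : 'rV[R]_n) (mu : probability (borelRn R n) R) : Prop :=
  forall U : set 'rV[R]_n, open U -> K `<=` U -> jensen_open U z mu.

Definition jensen (R : realType) (n : nat) (K : set 'rV[R]_n)
    (mu : probability (borelRn R n) R) : Prop :=
  exists2 z, K z & jensen_at K z mu.

(* An element of C(K) is represented by any function on R^n that restricts to
   it. *)
Definition subharmonic_near (R : realType) (n : nat) (K : set 'rV[R]_n)
    (g : 'rV[R]_n -> R) : Prop :=
  {within K, continuous g} /\
  exists (U : set 'rV[R]_n) (f : 'rV[R]_n -> \bar R),
    [/\ open U, K `<=` U, subharmonic U f
      & forall x, K x -> f x = (g x)%:E].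

(* S(K) *)
Definition SK (R : realType) (n : nat) (K : set 'rV[R]_n)
    (phi : 'rV[R]_n -> R) : Prop :=
  {within K, continuous phi} /\
  forall e : R, 0 < e -> exists2 g, subharmonic_near K g &
    forall x, K x -> `|phi x - g x| < e.

Definition jensen_succeq (R : realType) (n : nat) (K : set 'rV[R]_n)
    (mu nu : probability (borelRn R n) R) : Prop :=
  forall phi : 'rV[R]_n -> R, SK K phi ->
    (\int[nu]_(x in K) (phi x)%:E <= \int[mu]_(x in K) (phi x)%:E)%E.

Definition maximal_jensen (R : realType) (n : nat) (K : set 'rV[R]_n)
    (mu : probability (borelRn R n) R) : Prop :=
  jensen K mu /\
  ~ exists nu : probability (borelRn R n) R,
      [/\ jensen K nu, jensen_succeq K nu mu & ~ meas_eq nu mu].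

Definition dirichlet_solution (R : realType) (n : nat) (U : set 'rV[R]_n)
    (f h : 'rV[R]_n -> R) : Prop :=
  [/\ {within closure U, continuous h}, harmonic_on U h
    & forall x, bdry U x -> h x = f x].

Definition regular_open (R : realType) (n : nat) (U : set 'rV[R]_n) : Prop :=
  [/\ open U, bounded_set U
    & forall f : 'rV[R]_n -> R, {within bdry U, continuous f} ->
      exists h, dirichlet_solution U f h].

(* omega is the harmonic measure omega_U(z, .) of the regular open set U. *)
Definition harmonic_measure_open (R : realType) (n : nat) (U : set 'rV[R]_n)
    (z : 'rV[R]_n) (omega : probability (borelRn R n) R) : Prop :=
  omega (bdry U) = 1%E /\
  forall f h : 'rV[R]_n -> R, {within bdry U, continuous f} ->
    dirichlet_solution U f h ->
    ((h z)%:E = \int[omega]_(x in bdry U) (f x)%:E)%E.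

Definition regular_seq_to (R : realType) (n : nat) (K : set 'rV[R]_n)
    (U : nat -> set 'rV[R]_n) : Prop :=
  [/\ forall j, regular_open (U j),
      forall j, K `<=` U j,
      forall j, closure (U j.+1) `<=` U j
    & forall e : R, 0 < e -> exists j0 : nat, forall j, (j0 <= j)%N ->
      U j `<=` [set x | exists2 y, K y & enorm (x - y) < e]].

Definition weak_star_cvg (R : realType) (n : nat)
    (mu_ : nat -> probability (borelRn R n) R)
    (mu : probability (borelRn R n) R) : Prop :=
  forall g : 'rV[R]_n -> R, continuous g ->
    compact (closure [set x | g x != 0]) ->
    (\int[mu_ j]_x (g x)%:E)%E @[j --> \oo] --> (\int[mu]_x (g x)%:E)%E.

(* omega is the harmonic measure omega_K(z, .) of the compact set K: the weak*
   limit of omega_{U_j}(z, .). The limit is the same for every sequence (U_j),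
   so asking for one sequence is enough. *)
Definition harmonic_measure_compact (R : realType) (n : nat)
    (K : set 'rV[R]_n) (z : 'rV[R]_n)
    (omega : probability (borelRn R n) R) : Prop :=
  exists (U : nat -> set 'rV[R]_n)
         (omega_ : nat -> probability (borelRn R n) R),
    [/\ regular_seq_to K U,
        forall j, harmonic_measure_open (U j) z (omega_ j)
      & weak_star_cvg omega_ omega].

(* Main.v *)
(** A function h harmonic on a regular open set U and continuous up to its
    boundary dominates every subharmonic f with f <= h on the boundary.
    Solving the Dirichlet problem on the U_j with continuous data g >= f
    gives f(z) <= \int g d(omega_j), hence f(z) <= \int g d(omega) in the
    limit; letting g decrease to the upper semicontinuous f shows that omega
    is a Jensen measure at z.

    Conversely let nu be a Jensen measure with nu >= omega.  Testing against
    affine functions shows that nu has the same base point z.  For a function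
    phi continuous and subharmonic on R^n, with h_j the Dirichlet solution on
    U_j with data phi,
      \int phi d(nu) <= \int h_j d(nu) <= h_j(z) = \int phi d(omega_j),
    and the right-hand side tends to \int phi d(omega), so nu and omega
    integrate phi equally.  If m is continuous and subharmonic, so are
    max(k m, 0) + 1 and max(k m + 1, 0), whose difference increases to the
    indicator function of {m < 0}; these sets form a pi-system generating the
    Borel sets. *)

Require Import Defs.
From mathcomp Require Import all_boot all_order all_algebra.
From mathcomp Require Import all_classical all_reals all_analysis.
From mathcomp Require Import measurable_realfun ring lra.

Set Implicit Arguments.
Unset Strict Implicit.
Unset Printing Implicit Defensive.

Import Order.TTheory GRing.Theory Num.Theory.
Import numFieldNormedType.Exports.

Local Open Scope classical_set_scope.
Local Open Scope ring_scope.

(** * Euclidean norm *)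

Section euclidean_norm.
Context (R : realType) (n : nat).
Implicit Types (x y c : 'rV[R]_n) (r : R).

Lemma enorm_ge0 x : 0 <= enorm x.
Proof. exact: sqrtr_ge0. Qed.

Lemma sqr_enorm x : enorm x ^+ 2 = \sum_(i < n) x ord0 i ^+ 2.
Proof. by rewrite sqr_sqrtr// sumr_ge0// => i _; exact: sqr_ge0. Qed.

Lemma enorm0 : enorm (0 : 'rV[R]_n) = 0.
Proof.
by rewrite /enorm big1 ?sqrtr0// => i _; rewrite mxE expr0n.
Qed.

Lemma continuous_coord (i : 'I_n) : continuous (fun x : 'rV[R]_n => x ord0 i).
Proof. exact: coord_continuous. Qed.

Lemma continuous_sumr (T : topologicalType) m (f : 'I_m -> T -> R) :
  (forall i, continuous (f i)) -> continuous (fun t => \sum_(i < m) f i t).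
Proof.
elim: m f => [|m IH] f cf.
  rewrite (_ : (fun _ => _) = cst 0); first exact: cst_continuous.
  by apply/funext => t; rewrite big_ord0.
rewrite (_ : (fun _ => _) =
  (fun t => \sum_(i < m) f (widen_ord (leqnSn m) i) t + f ord_max t)); last first.
  by apply/funext => t; rewrite big_ord_recr.
by move=> t; apply: cvgD; [apply: (IH (fun i => f (widen_ord (leqnSn m) i)))|exact: cf].
Qed.

Lemma continuous_enormB c : continuous (fun x => enorm (x - c)).
Proof.
move=> x; apply: (@continuous_comp _ _ _
  (fun x : 'rV[R]_n => \sum_(i < n) (x - c) ord0 i ^+ 2)); last first.
  exact: sqrt_continuous.
apply: continuous_sumr => i {}x.
have ci : {for x, continuous (fun y : 'rV[R]_n => (y - c) ord0 i)}.
  rewrite (_ : (fun _ => _) = (fun y => y ord0 i - c ord0 i)).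
    exact: (cvgB (@continuous_coord i x) (cvg_cst (c ord0 i))).
  by apply/funext => y; rewrite !mxE.
rewrite (_ : (fun _ => _) =
  (fun y : 'rV[R]_n => (y - c) ord0 i * (y - c) ord0 i)).
  exact: (cvgM ci ci).
by apply/funext => y; rewrite expr2.
Qed.

Lemma normr_coord_le x i : `|x ord0 i| <= `|x|.
Proof.
by rewrite [leRHS]/Num.Def.normr /= mx_normrE; apply/bigmax_geP; right => /=; exists (ord0, i).
Qed.

Lemma normr_rV_le x (a : R) : 0 <= a -> (forall i, `|x ord0 i| <= a) -> `|x| <= a.
Proof.
move=> a0 xa; rewrite [leLHS]/Num.Def.normr /= mx_normrE; apply: bigmax_le => // -[i j] _ /=.
by rewrite ord1.
Qed.

Lemma normr_le_enorm x : `|x| <= enorm x.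
Proof.
apply: normr_rV_le => [|i]; first exact: enorm_ge0.
rewrite -(@ler_pXn2r _ 2)// ?nnegrE ?enorm_ge0//.
rewrite sqr_enorm real_normK ?num_real// (bigD1 i)//= lerDl sumr_ge0// => j _.
exact: sqr_ge0.
Qed.

Lemma eball_open c r : open (eball c r).
Proof.
rewrite (_ : eball c r = (fun x => enorm (x - c)) @^-1` [set t | t < r])//.
by apply: open_comp; [move=> x _; exact: continuous_enormB|exact: open_lt].
Qed.

Lemma ecball_closed c r : closed (ecball c r).
Proof.
rewrite (_ : ecball c r = (fun x => enorm (x - c)) @^-1` [set t | t <= r])//.
by apply: closed_comp; [move=> x _; exact: continuous_enormB|exact: closed_le].
Qed.

Lemma ecball_compact c r : compact (ecball c r).
Proof.
apply: bounded_closed_compact; last exact: ecball_closed.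
exists (r + `|c|); split; first exact: num_real.
move=> M rM x /= xr; rewrite -(subrK c x); apply: (le_trans (ler_normD _ _)).
by apply: le_trans (ltW rM); rewrite lerD2r (le_trans (normr_le_enorm _)).
Qed.

Lemma eball_ecball c r : eball c r `<=` ecball c r.
Proof. by move=> x; exact: ltW. Qed.

Lemma esphere_ecball c r : esphere c r `<=` ecball c r.
Proof. by move=> x; rewrite /esphere /ecball /= => ->. Qed.

Lemma eball_center c r : 0 < r -> eball c r c.
Proof. by move=> r0; rewrite /eball /= subrr enorm0. Qed.

(** Library neighbourhoods are sup norm balls. Since the sup norm is at most [enorm], the closed
    Euclidean ball of half the radius fits inside. *)
Lemma open_ecball (U : set 'rV[R]_n) x : open U -> U x ->
  exists2 r, 0 < r & ecball x r `<=` U.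
Proof.
move=> oU Ux; have /nbhs_ballP[e /= e0 eU] : nbhs x U by exact: open_nbhs_nbhs.
exists (e / 2); first by rewrite divr_gt0.
move=> y xy; apply: eU; rewrite mx_norm_ball /ball_ /= distrC.
apply: (le_lt_trans (normr_le_enorm _)); apply: (le_lt_trans xy).
by rewrite ltr_pdivrMr// ltr_pMr// ltr1n.
Qed.

End euclidean_norm.

(** * The Euclidean inner product *)

Definition dot (R : realType) (n : nat) (x y : 'rV[R]_n) : R :=
  \sum_(i < n) x ord0 i * y ord0 i.

Section dot.
Context (R : realType) (n : nat).
Implicit Types (x y c : 'rV[R]_n).

Lemma dotDr x y z : dot x (y + z) = dot x y + dot x z.
Proof. by rewrite -big_split; apply: eq_bigr => i _ /=; rewrite mxE mulrDr. Qed.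

Lemma dotZr x (a : R) y : dot x (a *: y) = a * dot x y.
Proof. by rewrite mulr_sumr; apply: eq_bigr => i _; rewrite mxE mulrCA. Qed.

Lemma dot_basis_vec x (i : 'I_n) : dot x (basis_vec R i) = x ord0 i.
Proof.
rewrite /dot (bigD1 i)//= big1 => [|j ji]; last first.
  by rewrite /basis_vec mxE (negPf ji) andbF mulr0.
by rewrite /basis_vec mxE !eqxx mulr1 addr0.
Qed.

Lemma dotC x y : dot x y = dot y x.
Proof. by apply: eq_bigr => i _; rewrite mulrC. Qed.

Lemma dotxx x : dot x x = enorm x ^+ 2.
Proof. by rewrite sqr_enorm. Qed.

Lemma sqr_enormD x y : enorm (x + y) ^+ 2 = enorm x ^+ 2 + 2 * dot x y + enorm y ^+ 2.
Proof. by rewrite -!dotxx dotDr dotC dotDr [dot (x + y) y]dotC dotDr (dotC y x); ring. Qed.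

Lemma enorm_basis_vec (t : R) (i : 'I_n) : enorm (t *: basis_vec R i) = `|t|.
Proof.
rewrite -[LHS]ger0_norm ?enorm_ge0// -!sqrtr_sqr -dotxx dotZr dotC dotZr.
by rewrite dot_basis_vec /basis_vec mxE !eqxx mulr1 expr2.
Qed.

End dot.

(** * Directional derivatives *)

Section directional_derivatives.
Context (R : realType).

Lemma near_eq_continuous (T U : topologicalType) (f g : T -> U) (x : T) :
  (\forall y \near x, f y = g y) -> {for x, continuous f} -> {for x, continuous g}.
Proof.
move=> fg cf; rewrite /prop_for /continuous_at -(nbhs_singleton fg).
exact: cvg_trans (near_eq_cvg fg) cf.
Qed.

Lemma is_derive_affine (V : normedModType R) (f : V -> R) (x v : V) (d : R) :
  (forall h : R, f (h *: v + x) = f x + h * d) -> is_derive x v f d.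
Proof.
move=> fE; have dfx : (fun h => h^-1 *: ((f \o shift x) (h *: v) - f x)) @ 0^' --> d.
  apply: cvg_near_cst; near=> h; rewrite /= fE addrC addKr.
  by rewrite scalerA mulVf ?scale1r//; near: h; exact: nbhs_dnbhs_neq.
by apply: DeriveDef; [apply/cvg_ex; exists d|exact: cvg_lim dfx].
Unshelve. all: by end_near. Qed.

Lemma is_derive_line (V : normedModType R) (f : V -> R) (x v : V) (t d : R) :
  is_derive (x + t *: v) v f d -> is_derive t 1 (fun s => f (x + s *: v)) d.
Proof.
move=> [df fd]; have E : (fun h : R =>
    h^-1 *: (((fun s => f (x + s *: v)) \o shift t) (h *: (1 : R)) - f (x + t *: v))) =
    (fun h => h^-1 *: ((f \o shift (x + t *: v)) (h *: v) - f (x + t *: v))).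
  apply/funext => h /=; congr (_ *: (f _ - _)).
  by rewrite scalerDl addrCA [h *: (1 : R)]mulr1.
by apply: DeriveDef; [rewrite /derivable E|rewrite /derive E].
Qed.

(** Subtracting the quadratic minorant leaves a function [psi] with a local minimum at 0, so
    [phi1 0 = b]. If [a < 2 * e], then [phi1 t] lies below [b + 2 * e * t] for small [t > 0], and
    the mean value theorem pushes [psi] below its minimum. *)
Lemma second_derivative_ge (phi phi1 : R -> R) (a b e r : R) : 0 < r ->
  (forall t : R, `|t| < r -> is_derive t 1 phi (phi1 t)) ->
  is_derive (0 : R) 1 phi1 a ->
  (forall t, `|t| < r -> phi 0 + b * t + e * t ^+ 2 <= phi t) ->
  2 * e <= a.
Proof.
move=> r0 dphi dphi1 phige.
pose psi t := phi t - (b * t + e * t ^+ 2).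
have dpsi (t : R) : `|t| < r -> is_derive t 1 psi (phi1 t - (b + 2 * e * t)).
  move=> tr; have := dphi _ tr => dphit.
  apply: is_deriveB.
  rewrite (_ : (fun _ => _) = b *: id + e *: (id ^+ 2 : R -> R)); last first.
    by apply/funext => s; rewrite /= expr2.
  apply: is_derive_eq.
  by rewrite /GRing.scale/= expr1; ring.
have psi_min t : `|t| < r -> psi 0 <= psi t.
  move=> /phige; rewrite /psi; lra.
have phi10 : phi1 0 = b.
  have d0 : is_derive (0 : R) 1 psi 0.
    apply: (@derive1_at_min _ psi (- r) r 0) => //.
    - lra.
    - by move=> t; rewrite in_itv/= -ltr_norml => /dpsi[].
    - by rewrite in_itv/= oppr_lt0 r0.
    - by move=> t; rewrite in_itv/= -ltr_norml => /psi_min.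
  have := dpsi 0; rewrite normr0 => /(_ r0) d1.
  have := @derive_val _ _ _ _ _ _ _ d1; rewrite (@derive_val _ _ _ _ _ _ _ d0).
  lra.
rewrite leNgt; apply/negP => ae.
have [d d0 phi1_lt] : exists2 d, 0 < d & forall t, 0 < t -> t < d -> phi1 t < b + 2 * e * t.
  case: dphi1 => dphi1 phi1E.
  have : (fun h => h^-1 *: ((phi1 \o shift 0) (h *: (1 : R)) - phi1 0)) @ 0^' --> a.
    by rewrite -phi1E; exact: dphi1.
  move=> /(cvgr_lt a)/(_ _ ae)[d /= d0 dP]; exists d => // t t0 td.
  have := dP t; rewrite /ball_/= sub0r normrN gtr0_norm// gt_eqF// => /(_ td isT).
  rewrite addr0 [t *: (1 : R)]mulr1 phi10 [_ *: _]mulrC ltr_pdivrMr//; lra.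
pose t0 := Num.min r d / 2.
have t00 : 0 < t0 by rewrite divr_gt0// lt_min r0.
have [t0r t0d] : t0 < r /\ t0 < d.
  have : t0 < Num.min r d by rewrite ltr_pdivrMr// ltr_pMr ?ltr1n// lt_min r0.
  by rewrite lt_min => /andP[].
have dpsiI (t : R) : t \in `]0, t0[%R -> is_derive t 1 psi (phi1 t - (b + 2 * e * t)).
  rewrite in_itv/= => /andP[t1 t2]; apply: dpsi; rewrite gtr0_norm//.
  exact: lt_trans t0r.
have cpsi : {within `[0, t0], continuous psi}.
  apply: derivable_within_continuous => t; rewrite in_itv/= => /andP[t1 t2].
  have tr : `|t| < r by rewrite ger0_norm//; exact: le_lt_trans t0r.
  by have [] := dpsi t tr.
have [c] := MVT t00 dpsiI cpsi.
rewrite in_itv/= => /andP[c0 ct0]; rewrite subr0 => psiE.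
have : psi 0 <= psi t0 by apply: psi_min; rewrite gtr0_norm.
have : (phi1 c - (b + 2 * e * c)) * t0 < 0.
  by rewrite nmulr_rlt0// subr_lt0 phi1_lt// (lt_trans ct0).
lra.
Qed.

End directional_derivatives.

(** * Harmonic and subharmonic functions *)

Lemma near_open (T : topologicalType) (U : set T) (x : T) : open U -> U x ->
  \forall y \near x, U y.
Proof. by move=> oU Ux; exact: open_nbhs_nbhs. Qed.

Section harmonic_functions.
Context (R : realType) (n : nat).
Implicit Types (U V : set 'rV[R]_n) (f g h : 'rV[R]_n -> R).

Lemma harmonic_onS U V h : V `<=` U -> harmonic_on U h -> harmonic_on V h.
Proof. by move=> VU [c l]; split=> x /VU; [exact: c|exact: l]. Qed.

Lemma partial_lin f g (k : R) (i : 'I_n) x :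
  derivable f x (basis_vec R i) -> derivable g x (basis_vec R i) ->
  is_derive x (basis_vec R i) (fun y => f y + k * g y) (partial i f x + k * partial i g x).
Proof.
move=> /derivableP df /derivableP dg.
have -> : (fun y => f y + k * g y) = f + k *: g by apply/funext.
exact: is_deriveD.
Qed.

(** Differentiating a first partial again requires knowing it on a whole neighbourhood of the point,
    which the openness of [U] supplies. *)
Lemma near_partial_lin U f g (k : R) (i : 'I_n) x : open U -> U x ->
  (forall y, U y -> derivable f y (basis_vec R i)) ->
  (forall y, U y -> derivable g y (basis_vec R i)) ->
  \forall y \near x, partial i f y + k * partial i g y =
    partial i (fun y => f y + k * g y) y.
Proof.
move=> oU Ux df dg; near=> y; have Uy : U y by near: y; exact: (near_open oU Ux).
by have [_ <-] := partial_lin k (df _ Uy) (dg _ Uy).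
Unshelve. all: by end_near. Qed.

Lemma continuous_lin f g (k : R) x : {for x, continuous f} -> {for x, continuous g} ->
  {for x, continuous (fun y => f y + k * g y)}.
Proof. by move=> cf cg; exact: (cvgD cf (cvgM (cvg_cst k) cg)). Qed.

Lemma harmonic_on_lin U f g (k : R) : open U -> harmonic_on U f -> harmonic_on U g ->
  harmonic_on U (fun x => f x + k * g x).
Proof.
move=> oU [Cf Lf] [Cg Lg]; have df1 i y : U y -> derivable f y (basis_vec R i).
  by move=> /Cf[_ /(_ i)[]].
have dg1 i y : U y -> derivable g y (basis_vec R i) by move=> /Cg[_ /(_ i)[]].
have df2 i j y : U y -> derivable (partial i f) y (basis_vec R j).
  by move=> /Cf[_ _ /(_ i j)[]].
have dg2 i j y : U y -> derivable (partial i g) y (basis_vec R j).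
  by move=> /Cg[_ _ /(_ i j)[]].
have D2 i j y : U y -> is_derive y (basis_vec R j) (partial i (fun x => f x + k * g x))
    (partial j (partial i f) y + k * partial j (partial i g) y).
  move=> Uy; apply: near_eq_is_derive (partial_lin k (df2 i j y Uy) (dg2 i j y Uy)).
  exact: (near_partial_lin k oU Uy (df1 i) (dg1 i)).
split=> [x Ux|x Ux].
  split.
  - by apply: continuous_lin; [have [] := Cf x Ux|have [] := Cg x Ux].
  - move=> i; split; first by have [] := partial_lin k (df1 i x Ux) (dg1 i x Ux).
    apply: near_eq_continuous; first exact: (near_partial_lin k oU Ux (df1 i) (dg1 i)).
    by apply: continuous_lin; [have [_ /(_ i)[]] := Cf x Ux|have [_ /(_ i)[]] := Cg x Ux].
  - move=> i j; split; first by have [] := D2 i j x Ux.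
    apply: (@near_eq_continuous _ _
        (fun y => partial j (partial i f) y + k * partial j (partial i g) y)).
      near=> y; have Uy : U y by near: y; exact: (near_open oU Ux).
      by have [_ <-] := D2 i j y Uy.
    by apply: continuous_lin; [have [_ _ /(_ i j)[]] := Cf x Ux|have [_ _ /(_ i j)[]] := Cg x Ux].
rewrite /laplacian (eq_bigr (fun i => partial i (partial i f) x + k * partial i (partial i g) x)).
  transitivity (laplacian f x + k * laplacian g x); last by rewrite Lf// Lg// mulr0 addr0.
  by rewrite /laplacian mulr_sumr -big_split.
by move=> i _; have [_ <-] := D2 i i x Ux.
Unshelve. all: by end_near. Qed.

Definition affine (a : 'rV[R]_n) (b : R) (y : 'rV[R]_n) : R := dot a y + b.

Lemma affine_continuous a b : continuous (affine a b).
Proof.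
have cd : continuous (dot a).
  apply: (@continuous_sumr R 'rV[R]_n n (fun i y => a ord0 i * y ord0 i)) => i y.
  exact: (cvgM (cvg_cst (a ord0 i)) (@continuous_coord R n i y)).
by move=> y; exact: (cvgD (cd y) (cvg_cst b)).
Qed.

Lemma harmonic_affine U a b : harmonic_on U (affine a b).
Proof.
have D1 (i : 'I_n) y : is_derive y (basis_vec R i) (affine a b) (a ord0 i).
  apply: is_derive_affine => h.
  by rewrite /affine dotDr dotZr dot_basis_vec; ring.
have pE i : partial i (affine a b) = cst (a ord0 i).
  by apply/funext => y; have [_ <-] := D1 i y.
have p2E i j : partial j (partial i (affine a b)) = cst 0.
  by apply/funext => y; rewrite pE /partial derive_cst.
split=> [x _|x _].
  split; first exact: affine_continuous.
  - by move=> i; split; [have [] := D1 i x|rewrite pE; exact: cst_continuous].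
  - move=> i j; split; first by rewrite pE; exact: derivable_cst.
    by rewrite p2E; exact: cst_continuous.
by rewrite /laplacian big1// => i _; rewrite p2E.
Qed.

(* Subtracting e |x - c|^2 from v makes the second derivatives at an interior
   minimum add up to a negative number. *)
Lemma harmonic_ball_ge0 (c : 'rV[R]_n) (r : R) (v : 'rV[R]_n -> R) : (0 < n)%N -> 0 < r ->
  {within ecball c r, continuous v} -> harmonic_on (eball c r) v ->
  (forall y, esphere c r y -> 0 <= v y) -> forall y, ecball c r y -> 0 <= v y.
Proof.
move=> n0 r0 cv [C2v Lv] vS p pr; rewrite leNgt; apply/negP => vp.
(* With this [e], the value of [w] on the sphere is at least [v p / 2], which exceeds [v p] and
   hence [w p]. The minimum of [w] is therefore attained in the open ball. *)
pose e := - v p / (2 * r ^+ 2).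
have e0 : 0 < e by rewrite divr_gt0 ?oppr_gt0// mulr_gt0// exprn_gt0.
have er : e * r ^+ 2 = - v p / 2 by rewrite /e; field; rewrite gt_eqF.
pose w y := v y - e * enorm (y - c) ^+ 2.
have cw : {within ecball c r, continuous w}.
  move=> y; apply: cvgB; first exact: cv.
  apply: cvgM; first exact: cvg_cst.
  have : {within ecball c r, continuous (fun x : 'rV[R]_n => enorm (x - c))}.
    exact/continuous_subspaceT/continuous_enormB.
  by move=> /(_ y) ce; rewrite expr2; under eq_fun do rewrite expr2; apply: cvgM.
have nonempty : ecball c r !=set0 by exists p.
have [x0 x0r wmin] := compact_EVT_min nonempty (@ecball_compact _ _ c r) cw.
have {}x0r : eball c r x0.
  move: x0r; rewrite inE /ecball /eball /= le_eqVlt => /orP[/eqP x0r|//].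
  have := wmin p; rewrite inE => /(_ pr); rewrite /w x0r er.
  have := vS _ x0r; have : 0 <= e * enorm (p - c) ^+ 2 by rewrite mulr_ge0 ?sqr_ge0// ltW.
  by move: vp; lra.
have [s s0 sr] := open_ecball (@eball_open _ _ c r) x0r.
have line i (t : R) : `|t| < s -> eball c r (x0 + t *: basis_vec R i).
  move=> ts; apply: sr; rewrite /ecball /= addrC addKr enorm_basis_vec; exact: ltW.
(* Minimality of [w] at [x0] bounds [v] from below, along each coordinate line, by a quadratic with
   leading coefficient [e]. Summing over [i] contradicts the vanishing of the Laplacian. *)
have key i : 2 * e <= partial i (partial i v) x0.
  apply: (@second_derivative_ge _ (fun t : R => v (x0 + t *: basis_vec R i))
    (fun t : R => partial i v (x0 + t *: basis_vec R i)) _ (2 * e * (x0 - c) ord0 i) e s s0).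
  - move=> t ts; apply: is_derive_line; apply/derivableP.
    by have [_ /(_ i)[]] := C2v _ (line i t ts).
  - apply: is_derive_line; rewrite scale0r addr0; apply/derivableP.
    by have [_ _ /(_ i i)[]] := C2v _ x0r.
  - move=> t ts; have := wmin (x0 + t *: basis_vec R i).
    rewrite inE => /(_ (eball_ecball (line i t ts))).
    rewrite /w scale0r addr0 (addrAC x0 (t *: basis_vec R i) (- c)) (sqr_enormD (x0 - c)).
    rewrite enorm_basis_vec dotZr dot_basis_vec.
    by rewrite real_normK ?num_real//; lra.
have : \sum_(i < n) 2 * e <= laplacian v x0 by apply: ler_sum => i _.
rewrite Lv// sumr_const card_ord leNgt => /negP; apply.
by rewrite pmulrn_rgt0// mulr_gt0.
Qed.

End harmonic_functions.

(** * Examples of subharmonic functions and operations preserving subharmonicity *)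

Section subharmonic_functions.
Context (R : realType) (n : nat) (n_gt0 : (0 < n)%N).
Implicit Types (U V : set 'rV[R]_n).

Lemma near_open_EFin_lt (h : 'rV[R]_n -> R) x (a : R) : {for x, continuous h} ->
  ((h x)%:E < a%:E)%E -> \forall y \near x, ((h y)%:E < a%:E)%E.
Proof. by rewrite lte_fin => ch ha; near=> y; rewrite lte_fin; near: y; exact: (cvgr_lt _ ch).
Unshelve. all: by end_near. Qed.

(** The difference between a harmonic majorant and [h] is harmonic in the ball and nonnegative on
    the sphere, so [harmonic_ball_ge0] applies to it. *)
Lemma harmonic_subharmonic U (h : 'rV[R]_n -> R) : open U -> harmonic_on U h ->
  subharmonic U (EFin \o h).
Proof.
move=> oU harm; split.
- by move=> x _; rewrite ltry.
- by move=> x Ux a; apply: near_open_EFin_lt; have [] := harm.1 x Ux.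
- move=> c r r0 crU g cg hg hS y yr; rewrite lee_fin -subr_ge0.
  have sub : eball c r `<=` U by apply: subset_trans crU; exact: eball_ecball.
  pose v x := g x + (- 1) * h x; rewrite (_ : g y - h y = v y); last by rewrite /v; ring.
  apply: (harmonic_ball_ge0 n_gt0 r0 _ _ _ yr).
  + move=> x; apply: cvgD; first exact: cg.
    apply: cvgM; first exact: cvg_cst.
    apply: (@continuous_in_subspaceT _ _ (ecball c r)) => {}x; rewrite inE => xr.
    by have [] := harm.1 x (crU _ xr).
  + exact: (harmonic_on_lin (-1) (@eball_open _ _ c r) hg (harmonic_onS sub harm)).
  + by move=> x /hS; rewrite lee_fin /v; lra.
Qed.

Lemma subharmonic_affine U a b : open U -> subharmonic U (EFin \o @affine R n a b).
Proof. by move=> oU; apply: harmonic_subharmonic => //; exact: harmonic_affine. Qed.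

Lemma subharmonic_max U (f g : 'rV[R]_n -> R) :
  subharmonic U (EFin \o f) -> subharmonic U (EFin \o g) ->
  subharmonic U (EFin \o (fun x => Num.max (f x) (g x))).
Proof.
move=> [f1 f2 f3] [g1 g2 g3]; split.
- by move=> x _; rewrite ltry.
- move=> x Ux a; rewrite lte_fin gt_max => /andP[fa ga].
  have fn := f2 x Ux a; have gn := g2 x Ux a.
  near=> y; rewrite lte_fin gt_max -!lte_fin; apply/andP; split; near: y.
  + by apply: fn; rewrite lte_fin.
  + by apply: gn; rewrite lte_fin.
- move=> c r r0 crU h ch hh hS y yr; rewrite lee_fin ge_max -!lee_fin.
  apply/andP; split.
  + by apply: (f3 c r) => // z /hS; rewrite !lee_fin ge_max => /andP[].
  + by apply: (g3 c r) => // z /hS; rewrite !lee_fin ge_max => /andP[].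
Unshelve. all: by end_near. Qed.

Lemma subharmonic_scale U (f : 'rV[R]_n -> R) (a b : R) : 0 < a ->
  subharmonic U (EFin \o f) -> subharmonic U (EFin \o (fun x => a * f x + b)).
Proof.
move=> a0 [f1 f2 f3].
(* A majorant [h] of [a * f + b] yields the majorant [(h - b) / a] of [f]. The constant [- b / a] is
   written as an [affine] function of zero slope so that [harmonic_on_lin] applies. *)
have leE (s t : R) : (a * s + b <= t) = (s <= affine 0 (- b / a) (0 : 'rV[R]_n) + a^-1 * t).
  rewrite /affine dotxx enorm0 expr0n add0r mulrC -lerBrDr -ler_pdivlMr//.
  by congr (_ <= _); field; rewrite gt_eqF.
split.
- by move=> x _; rewrite ltry.
- move=> x Ux t; rewrite /= lte_fin -ltrBrDr -ltr_pdivlMl// -lte_fin => /(f2 x Ux) fn.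
  by near=> y; rewrite lte_fin -ltrBrDr -ltr_pdivlMl// -lte_fin; near: y.
- move=> c r r0 crU h ch hh hS y yr; rewrite lee_fin leE.
  have aE z z' : affine (0 : 'rV[R]_n) (- b / a) z = affine (0 : 'rV[R]_n) (- b / a) z'.
    by rewrite /affine -(scale0r (0 : 'rV_n)) !(dotC _ z) !(dotC _ z') !dotZr !mul0r.
  rewrite (aE _ y) -lee_fin.
  apply: (f3 c r r0 crU (fun z => affine 0 (- b / a) z + a^-1 * h z) _ _ _ y yr).
  + move=> x; apply: cvgD; last by apply: cvgM; [exact: cvg_cst|exact: ch].
    exact/continuous_subspaceT/affine_continuous.
  + exact: (harmonic_on_lin a^-1 (@eball_open _ _ c r) (harmonic_affine _ _ _) hh).
  + by move=> z /hS; rewrite !lee_fin leE (aE 0 z).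
Unshelve. all: by end_near. Qed.

(** The sup norm is the maximum of the coordinates and their opposites, so a harmonic majorant of it
    on the sphere dominates finitely many affine functions there, hence in the ball. *)
Lemma subharmonic_normB U (q : 'rV[R]_n) : open U ->
  subharmonic U (EFin \o (fun x => `|x - q|)).
Proof.
move=> oU; have cn : continuous (fun x : 'rV[R]_n => `|x - q|).
  by move=> x; exact: (cvg_norm (cvgB cvg_id (cvg_cst q))).
split.
- by move=> x _; rewrite ltry.
- by move=> x Ux a; apply: near_open_EFin_lt; exact: cn.
- move=> c r r0 crU h ch hh hS y yr; rewrite lee_fin.
  have coord (s : R) i : `|s| = 1 -> s * (y - q) ord0 i <= h y.
    move=> s1; pose a := s *: basis_vec R i.
    have aE z : affine a (- (s * q ord0 i)) z = s * (z - q) ord0 i.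
      by rewrite /affine dotC dotZr dot_basis_vec !mxE; ring.
    rewrite -aE -lee_fin; have [_ _ aS] := subharmonic_affine a (- (s * q ord0 i)) oU.
    apply: (aS c r) => // z /hS; rewrite !lee_fin aE; apply: le_trans.
    by rewrite (le_trans (ler_norm _))// normrM s1 mul1r normr_coord_le.
  have coordn i : `|(y - q) ord0 i| <= h y.
    rewrite ler_norml; apply/andP; split.
      by have := coord (-1) i; rewrite normrN1 => /(_ erefl); lra.
    by have := coord 1 i; rewrite normr1 mul1r => /(_ erefl).
  apply: normr_rV_le => //; exact: le_trans (coordn (Ordinal n_gt0)).
Qed.

End subharmonic_functions.

(** * The maximum principle *)

Section maximum_principle.
Context (R : realType).

(** Compactness turns local upper bounds into a global one, and is used twice: near [+oo] to bound
    [u], then just to the left of the supremum [M]. If [M] were not attained, some [a < M] would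
    bound [u] on all of [C]. *)
Lemma usc_attains_max (T : topologicalType) (C : set T) (u : T -> R) :
  compact C -> C !=set0 ->
  (forall x, C x -> forall a, u x < a -> \forall y \near x, C y -> u y < a) ->
  exists2 c, C c & forall y, C y -> u y <= u c.
Proof.
move=> cptC [p Cp] uscu; have covC := (compact_near_coveringP C).1 cptC.
have [A uA] : exists A, forall y, C y -> u y <= A.
  have : \forall a \near +oo, C `<=` (fun x => C x -> u x <= a).
    apply: covC => x Cx; have ux1 : u x < u x + 1 by rewrite ltrDl.
    exists ([set y | C y -> u y < u x + 1], [set a | u x + 1 <= a]) => /=.
      by split; [exact: (uscu _ Cx _ ux1)|exact: nbhs_pinfty_ge (num_real _)].
    by move=> [y a] /= [uy ua] Cy; exact: le_trans (ltW (uy Cy)) ua.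
  by case=> A [_ /(_ (A + 1))]; rewrite ltrDl => /(_ ltr01) CA; exists (A + 1) => y Cy; exact: CA.
pose M := sup (u @` C).
have hsM : has_sup (u @` C) by split; [exists (u p), p|exists A => _ [y Cy <-]; exact: uA].
have uM y : C y -> u y <= M by move=> Cy; apply: sup_upper_bound => //; exists y.
apply: contrapT => noc.
have ltM y : C y -> u y < M.
  move=> Cy; rewrite lt_neqAle uM// andbT; apply/eqP => uyM; apply: noc.
  by exists y => // z Cz; rewrite uyM uM.
have : \forall a \near M^'-, C `<=` (fun x => C x -> u x <= a).
  apply: covC => x Cx; pose b := (u x + M) / 2.
  have [uxb bM] : u x < b /\ b < M by have := ltM _ Cx; rewrite /b; lra.
  exists ([set y | C y -> u y < b], [set a | b <= a]) => /=.
    by split; [exact: (uscu _ Cx _ uxb)|exact: nbhs_left_ge].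
  by move=> [y a] /= [uy ba] Cy; exact: le_trans (ltW (uy Cy)) ba.
move=> Ca; have [a [aM {}Ca]] : exists a, a < M /\ C `<=` (fun x => C x -> u x <= a).
  near (M^'-) => a; exists a; split; first by near: a; exact: nbhs_left_lt.
  by near: a.
have : M <= a by apply: ge_sup; [exists (u p), p|move=> _ [y Cy <-]; exact: Ca].
by rewrite leNgt aM.
Unshelve. all: by end_near. Qed.

(* Adding e |x|^2 to the excess of f over h moves its maximum to a point x0 near
   which f lies below h plus an affine function that is too small at x0. *)
Lemma subharmonic_le_harmonic (n : nat) (U V : set 'rV[R]_n) (f : 'rV[R]_n -> \bar R)
    (h : 'rV[R]_n -> R) :
  (0 < n)%N -> open U -> compact (closure U) -> closure U `<=` V ->
  subharmonic V f -> {within closure U, continuous h} -> harmonic_on U h ->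
  (forall y, bdry U y -> (f y <= (h y)%:E)%E) ->
  forall y, closure U y -> (f y <= (h y)%:E)%E.
Proof.
move=> n_gt0 oU cptU UV [fy fusc fmax] ch hh fbd p Up.
rewrite leNgt; apply/negP => fp.
(* Replacing [f] by its maximum with [h] makes the excess [u] real-valued even where [f] is [-oo];
   [u] vanishes wherever [f] is below [h]. *)
pose g y := fine (maxe (f y) (h y)%:E); pose u y := g y - h y.
have gE y : closure U y -> (g y)%:E = maxe (f y) (h y)%:E.
  move=> /UV /fy fyy; rewrite /g fineK// fin_numE -ltNye -ltey; apply/andP; split.
    by rewrite lt_max ltNyr orbT.
  by rewrite gt_max fyy ltry.
have u_ge0 y : closure U y -> 0 <= u y.
  by move=> Uy; rewrite subr_ge0 -lee_fin gE// le_max lexx orbT.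
have fu y : closure U y -> (f y <= (h y + u y)%:E)%E.
  by move=> Uy; rewrite /u addrC subrK gE// le_max lexx.
have ult y a : closure U y -> 0 < a -> (f y < (h y + a)%:E)%E -> u y < a.
  move=> Uy a0 fya; rewrite ltrBlDl -lte_fin gE// gt_max fya/= lte_fin; lra.
have up0 : 0 < u p.
  by rewrite subr_gt0 -lte_fin gE// lt_max fp.
have [q _ qmax] := compact_EVT_max (ex_intro _ p Up) cptU
  (continuous_subspaceT (@continuous_enormB R n 0)).
pose B := enorm q ^+ 2 + 1.
have B0 : 0 < B by rewrite ltr_wpDl// sqr_ge0.
have UB y : closure U y -> enorm y ^+ 2 < B.
  move=> Uy; rewrite ltr_pwDr// lerXn2r ?nnegrE ?enorm_ge0//.
  by have := qmax y; rewrite inE !subr0; apply.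
(* The perturbation [e * enorm y ^+ 2] stays below [u p / 2] on [closure U]. A maximum point [x0] of
   the perturbed excess thus has [u x0 > u p / 2], which excludes the boundary. *)
pose e := u p / (2 * B).
have e0 : 0 < e by rewrite divr_gt0// mulr_gt0.
have eB : e * B = u p / 2 by rewrite /e; field; rewrite gt_eqF.
have eUB y : closure U y -> e * enorm y ^+ 2 < u p / 2.
  by move=> Uy; rewrite -eB ltr_pM2l// UB.
have e_ge0 y : 0 <= e * enorm (y : 'rV[R]_n) ^+ 2 by rewrite mulr_ge0 ?sqr_ge0// ltW.
have cq : continuous (fun y : 'rV[R]_n => e * enorm y ^+ 2).
  move=> y; have ce : {for y, continuous (fun y : 'rV[R]_n => enorm y)}.
    rewrite (_ : (fun _ => _) = (fun y => enorm (y - 0))); first exact: continuous_enormB.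
    by apply/funext => z; rewrite subr0.
  rewrite (_ : (fun _ => _) = (fun y : 'rV[R]_n => e * (enorm y * enorm y))).
    exact: (cvgM (cvg_cst e) (cvgM ce ce)).
  by apply/funext => z; rewrite expr2.
have uscu x : closure U x -> forall a, u x + e * enorm x ^+ 2 < a ->
    \forall y \near x, closure U y -> u y + e * enorm y ^+ 2 < a.
  move=> Ux a xa; pose d := (a - (u x + e * enorm x ^+ 2)) / 4.
  have d0 : 0 < d by rewrite divr_gt0// subr_gt0.
  have fxd : (f x < (h x + u x + d)%:E)%E.
    by apply: le_lt_trans (fu _ Ux) _; rewrite lte_fin ltrDl.
  have nf := fusc _ (UV _ Ux) _ fxd.
  have nh : \forall y \near x, closure U y -> h x - d < h y.
    move/subspace_continuousP : ch => /(_ x Ux) chx.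
    by apply: (cvgr_gt (h x) chx); rewrite ltrBlDr ltrDl.
  have nq : \forall y \near x, e * enorm (y : 'rV[R]_n) ^+ 2 < e * enorm x ^+ 2 + d.
    by apply: (cvgr_lt _ (cq x)); rewrite ltrDl.
  near=> y => Uy.
  have uy : u y < u x + 2 * d.
    apply: ult => //; first by have := u_ge0 _ Ux; lra.
    have fy' : (f y < (h x + u x + d)%:E)%E by near: y.
    apply: lt_le_trans fy' _; rewrite lee_fin.
    have : h x - d < h y by move: Uy; near: y.
    lra.
  have : e * enorm y ^+ 2 < e * enorm x ^+ 2 + d by near: y.
  by move: uy; rewrite /d; lra.
have [x0 Ux0 x0max] := usc_attains_max cptU (ex_intro _ p Up) uscu.
have ux0 : u p / 2 < u x0.
  by have := x0max _ Up; have := eUB _ Ux0; have := e_ge0 p; lra.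
have {}Ux0 : U x0.
  apply: contrapT => nUx0.
  have : (f x0 <= (h x0)%:E)%E by apply: fbd; split => // /interior_subset.
  move=> /max_idPr fh; have := gE _ Ux0; rewrite fh => -[gh].
  by move: ux0 up0; rewrite /u gh subrr; lra.
have Ux0' : closure U x0 by exact: subset_closure.
have [r r0 rU] := open_ecball oU Ux0.
have rU' : ecball x0 r `<=` closure U by move=> y /rU; exact: subset_closure.
(* Expanding [enorm y ^+ 2] around [x0] in the maximality inequality gives [u y <= affine a b y]
   when [enorm (y - x0) = r]. At [x0] this affine function equals [u x0 - e * r ^+ 2], which is less
   than [u x0]. *)
pose a := (- (2 * e)) *: x0; pose b := u x0 - e * r ^+ 2 + 2 * e * enorm x0 ^+ 2.
have abE y : affine a b y = u x0 - e * r ^+ 2 - 2 * e * dot x0 (y - x0).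
  by rewrite /affine /a /b (dotC _ y) dotZr (dotC y) dotDr -[- x0]scaleN1r dotZr dotxx; ring.
have := fmax x0 r r0 (subset_trans rU' UV) (fun y => h y + 1 * affine a b y).
have c1 : {within ecball x0 r, continuous (fun y => h y + 1 * affine a b y)}.
  have ch' := continuous_subspaceW rU' ch.
  have ca : {within ecball x0 r, continuous (affine a b)}.
    exact/continuous_subspaceT/affine_continuous.
  move=> y; apply: cvgD; first exact: ch'.
  by apply: cvgM; [exact: cvg_cst|exact: ca].
have h1 : harmonic_on (eball x0 r) (fun y => h y + 1 * affine a b y).
  apply: (harmonic_on_lin 1 (@eball_open _ _ x0 r)); last exact: harmonic_affine.
  by apply: harmonic_onS hh => y /eball_ecball /rU.
move=> /(_ c1 h1) H; have {}H := H _ x0 (eball_ecball (eball_center _ r0)).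
have : (f x0 <= (h x0 + 1 * affine a b x0)%:E)%E.
  apply: H => y yr; have Uy := rU' _ (esphere_ecball yr).
  apply: le_trans (fu _ Uy) _; rewrite lee_fin lerD2l mul1r abE.
  have := x0max _ Uy; rewrite -{2}(subrK x0 y) [y - x0 + x0]addrC sqr_enormD.
  by rewrite yr; lra.
rewrite mul1r abE subrr -(scale0r (0 : 'rV[R]_n)) dotZr mul0r mulr0 subr0.
(* Since [u x0 > 0], the maximum defining [g x0] is reached by [f]. *)
have fx0 : f x0 = (h x0 + u x0)%:E.
  rewrite /u addrC subrK gE//; apply/esym/max_idPl.
  rewrite leNgt; apply/negP => /ltW /max_idPr fh.
  have := gE _ Ux0'; rewrite fh => -[] gh; move: ux0 up0; rewrite /u gh subrr; lra.
have : 0 < e * r ^+ 2 by rewrite mulr_gt0// exprn_gt0.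
by rewrite fx0 lee_fin; lra.
Unshelve. all: by end_near. Qed.

End maximum_principle.

(** * Borel measures on R^n *)

Lemma continuous_maxr (R : realType) (T : topologicalType) (f g : T -> R) :
  continuous f -> continuous g -> continuous (fun x => Num.max (f x) (g x)).
Proof. by move=> cf cg x; exact: (@continuous_max R T f g x (cf x) (cg x)). Qed.

Section borel_rn.
Context (R : realType) (n : nat).
Implicit Types (U V : set 'rV[R]_n).
Local Notation T := (borelRn R n).

(** Sup norm balls have centres that are easily approximated by rational vectors, and they are
    sublevel sets of the subharmonic functions in [csubharmonic_normB]. *)
Definition nball (c : 'rV[R]_n) (r : R) : set 'rV[R]_n := [set x | `|x - c| < r].

Lemma continuous_normB (c : 'rV[R]_n) : continuous (fun x : 'rV[R]_n => `|x - c|).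
Proof. by move=> x; exact: (cvg_norm (cvgB cvg_id (cvg_cst c))). Qed.

Lemma nball_open c r : open (nball c r).
Proof.
rewrite (_ : nball c r = (fun x => `|x - c|) @^-1` [set t | t < r])//.
by apply: open_comp; [move=> x _; exact: continuous_normB|exact: open_lt].
Qed.

Lemma closure_norm_le (A : set 'rV[R]_n) c r :
  (forall x, A x -> `|x - c| <= r) -> forall x, closure A x -> `|x - c| <= r.
Proof.
move=> Ar; have cl : closed ((fun x : 'rV[R]_n => `|x - c|) @^-1` [set t | t <= r]).
  by apply: closed_comp; [move=> y _; exact: continuous_normB|exact: closed_le].
suff : closure A `<=` (fun x : 'rV[R]_n => `|x - c|) @^-1` [set t | t <= r] by [].
by rewrite ((closure_id _).1 cl); exact: closureS.
Qed.

Lemma compact_closure (A : set 'rV[R]_n) c r :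
  (forall x, A x -> `|x - c| <= r) -> compact (closure A).
Proof.
move=> /closure_norm_le Ar; apply: bounded_closed_compact; last exact: closed_closure.
exists (r + `|c|); split; first exact: num_real.
move=> M rM x /= /Ar xr; rewrite -(subrK c x) (le_trans (ler_normD _ _))//.
by rewrite (le_trans _ (ltW rM))// lerD2r.
Qed.

Lemma countable_nball_base : exists B : nat -> set 'rV[R]_n,
  (forall k, exists c r, B k = nball c r) /\
  (forall V x, open V -> V x -> exists k, B k x /\ B k `<=` V).
Proof.
(* The balls with rational centre and radius are enumerated through their codes; [nball 0 0] is
   empty and serves as default. *)
pose B k := if @unpickle ('rV[rat]_n * rat)%type k is Some i
  then nball (map_mx ratr i.1) (ratr i.2) else nball 0 0.
exists B; split => [k|V x oV Vx].
  by rewrite /B; case: unpickle => [i|]; do 2 eexists; reflexivity.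
have /nbhs_ballP[e /= e0 eV] : nbhs x V by exact: open_nbhs_nbhs.
have [q qx] : exists q : 'I_n -> rat, forall i, `|x ord0 i - ratr (q i)| < e / 4.
  suff /choice[q] : forall i, exists q : rat, `|x ord0 i - ratr q| < e / 4 by exists q.
  move=> i; have [|q] := @rat_in_itvoo R (x ord0 i - e / 4) (x ord0 i + e / 4); first lra.
  by rewrite in_itv/= => /andP[q1 q2]; exists q; rewrite ltr_norml; apply/andP; split; lra.
(* The centre is within [e / 4] of [x], so a radius above [e / 4] captures [x], while one below
   [e / 2] keeps the ball within distance [e] of [x]. *)
have [|r] := @rat_in_itvoo R (e / 4) (e / 2); first lra.
rewrite in_itv/= => /andP[r1 r2].
pose Q : 'rV[rat]_n := \row_i q i; exists (pickle (Q, r)).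
have xQ : `|x - map_mx ratr Q| <= e / 4.
  apply: normr_rV_le => [|i]; first lra.
  by rewrite !mxE ltW.
rewrite /B pickleK/= /nball/=; split; first exact: le_lt_trans r1.
move=> y /= yQ; apply: eV; rewrite mx_norm_ball /ball_/=.
rewrite -(subrKA (map_mx ratr Q)) (le_lt_trans (ler_normD _ _))//.
by move: yQ; rewrite distrC; lra.
Qed.

Lemma open_measurable_rV U : open U -> measurable (U : set T).
Proof. by move=> oU; exact: sub_sigma_algebra. Qed.

Lemma closed_measurable_rV U : closed U -> measurable (U : set T).
Proof.
move=> cU; rewrite -(setCK U); apply: measurableC; apply: open_measurable_rV.
exact: closed_openC.
Qed.

Lemma usc_measurable U (f : 'rV[R]_n -> \bar R) : open U -> usc_on U f ->
  measurable_fun (U : set T) (f : T -> \bar R).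
Proof.
move=> oU uscf; apply: (measurability _ (ErealGenInftyO.measurableE R)).
move=> /= _ [_ [a ->]] <-; apply: open_measurable_rV.
rewrite openE => x [Ux]; rewrite /= in_itv/= => fxa.
have nf := uscf x Ux a fxa; have nU := near_open oU Ux.
rewrite /interior; apply: filterS (filterI nU nf) => y [Uy fya].
by split; rewrite //= in_itv.
Qed.

Lemma continuous_usc U (f : 'rV[R]_n -> R) :
  (forall x, U x -> {for x, continuous f}) -> usc_on U (EFin \o f).
Proof. by move=> cf x Ux a; apply: near_open_EFin_lt; exact: cf. Qed.

Lemma continuous_measurable_rV (f : 'rV[R]_n -> R) : continuous f ->
  measurable_fun [set: T] (f : T -> R).
Proof.
move=> cf; apply/measurable_EFinP; apply: usc_measurable; first exact: openT.
by apply: continuous_usc => x _; exact: cf.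
Qed.

(** Positive and negative parts are treated separately, so the equality also covers functions with
    infinite integrals. *)
Lemma integral_full_subset d (X : measurableType d) (mu : {measure set X -> \bar R})
    (D E : set X) (f : X -> \bar R) :
  measurable D -> measurable E -> D `<=` E -> mu (E `\` D) = 0%E ->
  measurable_fun E f -> (\int[mu]_(x in E) f x = \int[mu]_(x in D) f x)%E.
Proof.
move=> mD mE DE mu0 mf; rewrite integralE [RHS]integralE.
have mED : measurable (E `\` D) by exact: measurableD.
have EDK : E `\` (E `\` D) = D by rewrite setDD; apply/setIidPr.
congr (_ - _)%E.
  by rewrite (ge0_negligible_integral mED mE _ _ mu0) ?EDK//; exact: measurable_funepos.
by rewrite (ge0_negligible_integral mED mE _ _ mu0) ?EDK//; exact: measurable_funeneg.
Qed.

(** Every point outside the support lies in a null ball of the countable base, so [O] is covered by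
    countably many null sets. *)
Lemma msupport_null (mu : probability T R) (O : set 'rV[R]_n) :
  open O -> (forall x, O x -> ~ msupport mu x) -> mu O = 0%E.
Proof.
move=> oO Omu; have [B [Bball Bbase]] := countable_nball_base.
have mB k : measurable (B k : set T).
  by apply: open_measurable_rV; have [c [r ->]] := Bball k; exact: nball_open.
pose F k : set T := if mu (B k) == 0%E then B k else set0.
have F0 k : mu.-negligible (F k).
  by rewrite /F; case: ifPn => [/eqP/negligibleP|_]; [apply|exact: negligible_set0].
apply/negligibleP; first exact: open_measurable_rV.
apply: negligibleS (negligible_bigcup F0) => x Ox.
have [V [oV Vx muV]] : exists V, [/\ open V, V x & mu V = 0%E].
  apply: contrapT => noV; apply: (Omu x Ox) => V oV Vx.
  rewrite lt0e measure_ge0 andbT; apply/eqP => muV; apply: noV; by exists V.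
have [k [Bx BV]] := Bbase V x oV Vx; exists k => //; rewrite /F.
have -> : mu (B k) = 0%E.
  apply/eqP; rewrite eq_le measure_ge0 andbT -muV le_measure// inE//.
  exact: open_measurable_rV.
by rewrite eqxx.
Qed.

(** It suffices to treat a base ball inside [O]. The tent function [psi] is positive exactly on that
    ball and has compact support; its integrals against [mu_ j] eventually vanish, hence so does its
    integral against [mu]. *)
Lemma weak_limit_null (mu_ : nat -> probability T R) (mu : probability T R)
    (O : set 'rV[R]_n) :
  weak_star_cvg mu_ mu -> open O -> (\forall j \near \oo, mu_ j O = 0%E) -> mu O = 0%E.
Proof.
move=> wcv oO O0; have [B [Bball Bbase]] := countable_nball_base.
pose F k : set T := if `[< B k `<=` O >] then B k else set0.
have F0 k : mu.-negligible (F k); last first.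
  apply/negligibleP; first exact: open_measurable_rV.
  apply: negligibleS (negligible_bigcup F0) => x Ox.
  have [k [Bx BV]] := Bbase O x oO Ox; exists k => //; rewrite /F.
  by rewrite (asboolT BV).
rewrite /F; case: asboolP => [BO|_]; last exact: negligible_set0.
have [c [r Bk]] := Bball k.
pose psi x : R := Num.max 0 (r - `|x - c|).
have cpsi : continuous psi.
  apply: continuous_maxr => x; first exact: cst_continuous.
  exact: (cvgB (cvg_cst r) (@continuous_normB c x)).
have psi0 x : ~ B k x -> psi x = 0.
  by rewrite Bk /nball/= => /negP; rewrite -leNgt => rx; apply/max_idPl; rewrite subr_le0.
have cptpsi : compact (closure [set x | psi x != 0]).
  apply: (@compact_closure _ c r) => x /= psix.
  by apply: ltW; apply: contrapT => nB; move/eqP: psix; apply; apply: psi0; rewrite Bk.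
have mpsi : measurable_fun [set: T] (EFin \o psi : T -> \bar R).
  by apply/measurable_EFinP; exact: continuous_measurable_rV.
have mO := open_measurable_rV oO.
have I0 : (\int[mu]_x (psi x)%:E = 0)%E.
  rewrite -(cvg_lim (@ereal_hausdorff R) (wcv psi cpsi cptpsi)).
  apply: cvg_lim => //; apply: cvg_near_cst; apply: filterS O0 => j muj0.
  rewrite (@integral_full_subset _ _ (mu_ j) (~` O))//.
  - rewrite (eq_integral (cst 0%E)) ?integral0// => x; rewrite inE => nO.
    by rewrite /= psi0// => /BO.
  - exact: measurableC.
  - by rewrite setTD setCK.
have psi_ge0 x : 0 <= psi x by rewrite le_max lexx.
have /(ae_eq_integral_abs mu measurableT mpsi) : (\int[mu]_x `|(EFin \o psi) x| = 0)%E.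
  by rewrite -[RHS]I0; apply: eq_integral => x _; rewrite /= ger0_norm.
apply: negligibleS => x Bx /= /(_ Logic.I) [psix].
move: Bx; rewrite Bk /nball/= => xr.
have : psi x <= 0 by rewrite psix.
by rewrite ge_max lexx/= subr_le0 leNgt xr.
Qed.

End borel_rn.

(** * Harmonic measure of a compact set *)

Section supports.
Context (R : realType) (n : nat).
Implicit Types (mu : probability (borelRn R n) R) (K : set 'rV[R]_n).

Lemma msupport_closed mu : closed (msupport mu).
Proof.
rewrite -(setCK (msupport mu)); apply: open_closedC; rewrite openE => x nx.
have [V [oV Vx muV]] : exists V, [/\ open V, V x & mu V = 0%E].
  apply: contrapT => noV; apply: nx => V oV Vx.
  by rewrite lt0e measure_ge0 andbT; apply/eqP => muV; apply: noV; exists V.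
rewrite /interior; apply: filterS (near_open oV Vx) => y Vy suppy.
by have := suppy V oV Vy; rewrite muV ltxx.
Qed.

Lemma msupport_subset mu K : closed K -> mu (~` K) = 0%E -> msupport mu `<=` K.
Proof.
move=> cK muK x suppx; apply: contrapT => nKx.
by have := suppx _ (closed_openC cK) nKx; rewrite muK ltxx.
Qed.

Lemma probability1_null mu (D : set 'rV[R]_n) :
  measurable (D : set (borelRn R n)) -> mu D = 1%E -> mu (~` D) = 0%E.
Proof. by move=> mD muD; rewrite (probability_setC mu mD) muD subee. Qed.

Lemma bdry_closed (U : set 'rV[R]_n) : closed (bdry U).
Proof.
rewrite /bdry setDE; apply: closedI; first exact: closed_closure.
by apply: open_closedC; exact: open_interior.
Qed.

Lemma bdry_closure (U : set 'rV[R]_n) : bdry U `<=` closure U.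
Proof. by move=> x []. Qed.

End supports.

(** * Regular neighbourhoods shrinking to [K] and the limit of their harmonic measures *)

Section regular_sequences.
Context (R : realType) (n : nat) (K : set 'rV[R]_n) (U : nat -> set 'rV[R]_n).
Hypotheses (clK : closed K) (KU : regular_seq_to K U).

Lemma regular_seq_closureS i j : (j <= i)%N -> closure (U i) `<=` closure (U j).
Proof.
have [_ _ UU _] := KU => /subnK <-; elim: (i - j)%N => [//|k IH].
by rewrite addSn => x /UU /subset_closure; exact: IH.
Qed.

Lemma regular_seq_compact j : compact (closure (U j)).
Proof.
have [Ureg _ _ _] := KU; have [_ [M [_ UM]] _] := Ureg j.
apply: (@compact_closure _ _ _ 0 (M + 1)) => x Ux; rewrite subr0.
by apply: UM => //; rewrite ltrDl.
Qed.

Lemma regular_seq_bigcap x : (forall j, U j x) -> K x.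
Proof.
have [_ _ _ Ue] := KU => Ux; rewrite ((closure_id K).1 clK) => B /nbhs_ballP[e /= e0 eB].
have [j0 /(_ j0 (leqnn _) x (Ux _))[y Ky xy]] := Ue e e0.
exists y; split => //; apply: eB; rewrite mx_norm_ball /ball_/=.
exact: le_lt_trans (normr_le_enorm _) xy.
Qed.

(** Each point of [closure (U 0)] either lies in [V] or has a neighbourhood missed by all late
    [closure (U j)], because these sets shrink to [K]. Compactness makes the index uniform. *)
Lemma regular_seq_sub V : open V -> K `<=` V ->
  exists j0, forall j, (j0 <= j)%N -> closure (U j) `<=` V.
Proof.
move=> oV KV; have [_ _ UU _] := KU.
have : \forall j \near \oo, closure (U 0) `<=` (fun y => closure (U j) y -> V y).
  have covU := (compact_near_coveringP _).1 (@regular_seq_compact 0); apply: covU => x _.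
  have [Vx|nVx] := pselect (V x).
    by exists (V, setT) => /=; [split; [exact: (near_open oV Vx)|exact: filterT]|case=> y j [/=]].
  have [j nUx] : exists j, ~ closure (U j) x.
    apply: contrapT => nj; apply: nVx; apply: KV; apply: regular_seq_bigcap => j.
    by apply: UU; apply: contrapT => nU; apply: nj; exists j.+1.
  exists (~` closure (U j), [set i | (j <= i)%N]) => /=.
    split; last exact: nbhs_infty_ge.
    exact: (near_open (closed_openC (@closed_closure _ _)) nUx).
  by move=> [y i] /= [nUy ji] /(regular_seq_closureS ji).
case=> j0 _ j0V; exists j0 => j jj x Ux; apply: (j0V j jj _ _ Ux).
exact: (regular_seq_closureS (leq0n j)).
Qed.

Context (z : 'rV[R]_n) (omega_ : nat -> probability (borelRn R n) R)
  (omega : probability (borelRn R n) R).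
Hypotheses (Kz : K z) (hm : forall j, harmonic_measure_open (U j) z (omega_ j))
  (wcv : weak_star_cvg omega_ omega).

Lemma harmonic_measure_bdry_null j : omega_ j (~` bdry (U j)) = 0%E.
Proof.
apply: probability1_null; last by have [] := hm j.
by apply: closed_measurable_rV; exact: bdry_closed.
Qed.

(** For [j >= k] the measure [omega_ j] is carried by [closure (U k)], so the weak limit gives no
    mass to the complement of any [closure (U k)]. These closures intersect in [K]. *)
Lemma harmonic_measure_compact_null : omega (~` K) = 0%E.
Proof.
have [_ _ UU _] := KU.
have F0 k : omega.-negligible (~` closure (U k) : set (borelRn R n)).
  have oF : open (~` closure (U k)) by apply: closed_openC; exact: closed_closure.
  apply/negligibleP; first exact: open_measurable_rV.
  apply: (weak_limit_null wcv) => //; near=> j.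
  apply/eqP; rewrite eq_le measure_ge0 andbT -(harmonic_measure_bdry_null j).
  rewrite le_measure ?inE//.
  - exact: open_measurable_rV.
  - by apply: open_measurable_rV; apply: closed_openC; exact: bdry_closed.
  - move=> x nUx /bdry_closure Ux; apply: nUx; move: x Ux; apply: regular_seq_closureS.
    by near: j; exact: nbhs_infty_ge.
apply/negligibleP.
  by apply: open_measurable_rV; exact: closed_openC.
apply: negligibleS (negligible_bigcup F0) => x nKx; apply: contrapT => nU.
apply: nKx; apply: regular_seq_bigcap => j; apply: UU; apply: contrapT => nUx.
by apply: nU; exists j.+1.
Unshelve. all: by end_near. Qed.

(** Weak convergence is tested on compactly supported functions only, so [g] is multiplied by a
    cutoff [chi] equal to 1 on [closure (U 0)], a set carrying all the measures involved. *)
Lemma harmonic_measure_cvg (g : 'rV[R]_n -> R) : continuous g ->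
  (\int[omega_ j]_(x in bdry (U j)) (g x)%:E)%E @[j --> \oo] -->
  (\int[omega]_(x in K) (g x)%:E)%E.
Proof.
move=> cg; have [_ KUj UU _] := KU.
have [M [_ /(_ (M + 1)) UM]] : bounded_set (closure (U 0)).
  exact/compact_bounded/regular_seq_compact.
have {}UM x : closure (U 0) x -> `|x| <= M + 1 by apply: UM; rewrite ltrDl.
pose chi (x : 'rV[R]_n) : R := Num.max 0 (Num.min 1 (M + 2 - `|x|)).
pose f x := g x * chi x.
have gf x : closure (U 0) x -> f x = g x.
  move=> /UM xM; rewrite /f /chi (min_idPl _) ?(max_idPr _) ?mulr1//.
  by lra.
have minE (a b : R) : Num.min a b = - Num.max (- a) (- b).
  by rewrite oppr_max !opprK.
have cf : continuous f.
  have cchi : continuous chi.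
    apply: continuous_maxr; first by move=> x; exact: cst_continuous.
    rewrite (_ : (fun x => _) = (fun x : 'rV[R]_n => - Num.max (- 1) (`|x| - (M + 2)))).
      have cm : continuous (fun x : 'rV[R]_n => Num.max (- 1) (`|x| - (M + 2))).
        apply: continuous_maxr; first by move=> x; exact: cst_continuous.
        by move=> x; exact: (cvgB (cvg_norm cvg_id) (cvg_cst (M + 2))).
      by move=> x; exact: (cvgN (cm x)).
    by apply/funext => x; rewrite minE opprB.
  by move=> x; exact: (cvgM (cg x) (cchi x)).
have cptf : compact (closure [set x | f x != 0]).
  apply: (@compact_closure _ _ _ 0 (M + 2)) => x /=; rewrite subr0; apply: contraR.
  rewrite -ltNge => Mx; apply/eqP; rewrite /f /chi (max_idPl _) ?mulr0//.
  by rewrite ge_min; apply/orP; right; lra.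
have mf : measurable_fun [set: borelRn R n] (EFin \o f : borelRn R n -> \bar R).
  by apply/measurable_EFinP; exact: continuous_measurable_rV.
have I D (mu : probability (borelRn R n) R) : closed D -> D `<=` closure (U 0) ->
    mu (~` D) = 0%E -> (\int[mu]_(x in D) (g x)%:E = \int[mu]_x (f x)%:E)%E.
  move=> cD DU muD; rewrite (@integral_full_subset _ _ _ mu D setT)//.
  - by apply: eq_integral => x; rewrite inE => /DU /gf ->.
  - exact: closed_measurable_rV.
  - by rewrite setTD.
rewrite (I K)//; last exact: harmonic_measure_compact_null.
  under eq_fun do rewrite (I _ (omega_ _) (@bdry_closed _ _ _)
    (subset_trans (@bdry_closure _ _ _) (regular_seq_closureS (leq0n _)))
    (harmonic_measure_bdry_null _)).
  exact: wcv.
by move=> x /(KUj 0); exact: subset_closure.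
Qed.

Lemma le_harmonic_measure_integral (V : set 'rV[R]_n) (f : 'rV[R]_n -> \bar R)
    (g : 'rV[R]_n -> R) (j0 : nat) : (0 < n)%N ->
  closure (U j0) `<=` V -> subharmonic V f -> continuous g ->
  (forall x, closure (U j0) x -> (f x <= (g x)%:E)%E) ->
  (f z <= \int[omega]_(x in K) (g x)%:E)%E.
Proof.
move=> n_gt0 UV shf cg fg; have [Ureg KUj _ _] := KU; have cvI := harmonic_measure_cvg cg.
rewrite -(cvg_lim (@ereal_hausdorff R) cvI); apply: lime_ge; first exact: cvgP cvI.
near=> j; have j0j : (j0 <= j)%N by near: j; exact: nbhs_infty_ge.
have cgb : {within bdry (U j), continuous g} by exact: continuous_subspaceT.
have [oU _ /(_ g cgb)[h hsol]] := Ureg j; have [ch hh hb] := hsol.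
have [_ /(_ g h cgb hsol) <-] := hm j.
apply: (subharmonic_le_harmonic n_gt0 oU (@regular_seq_compact j) _ shf ch hh).
- exact: subset_trans (regular_seq_closureS j0j) UV.
- move=> y yb; rewrite (hb y yb); apply: fg.
  exact: regular_seq_closureS j0j _ (bdry_closure yb).
- by apply: subset_closure; exact: KUj.
Unshelve. all: by end_near. Qed.

End regular_sequences.

(** * Harmonic measures are Jensen measures *)

Section usc_approximation.
Context (R : realType) (n : nat).

Lemma lipschitz_continuous_rV (g : 'rV[R]_n -> R) (k : R) :
  (forall x y, g x <= g y + k * `|x - y|) -> continuous g.
Proof.
move=> glip x; apply: (proj2 (@cvgrPdist_lt _ _ _ (nbhs x) _ _ _)) => e e0.
have ck : continuous (fun y : 'rV[R]_n => k * `|y - x|).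
  by move=> y; exact: (cvgM (cvg_cst k) (@continuous_normB R n x y)).
have nk : \forall y \near x, k * `|y - x| < e.
  have := ck x; rewrite /continuous_at subrr normr0 mulr0 => /cvgr_lt; exact.
near=> y; have yxe : k * `|y - x| < e by near: y.
have := glip x y; have := glip y x.
by rewrite (distrC x y) ltr_norml => *; apply/andP; split; lra.
Unshelve. all: by end_near. Qed.

Lemma lt_EFin_between (a : \bar R) (b : R) : (a < b%:E)%E ->
  exists2 c, (a < c%:E)%E & c < b.
Proof.
case: a => [a||]; rewrite ?ltNge ?leey//.
- by rewrite -ltNge lte_fin => ab; exists ((a + b) / 2); rewrite ?lte_fin; lra.
- by move=> _; exists (b - 1); rewrite ?ltNyr//; lra.
Qed.

(* The approximants are the sup-convolutions
   g_k(x) = sup_{y in C} (max (f y) (- k) - k |x - y|). *)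
Lemma usc_approximation (C : set 'rV[R]_n) (f : 'rV[R]_n -> \bar R) :
  compact C -> C !=set0 -> (forall x, C x -> (f x < +oo)%E) ->
  (forall x, C x -> forall a : R, (f x < a%:E)%E ->
    \forall y \near x, C y -> (f y < a%:E)%E) ->
  exists g : nat -> 'rV[R]_n -> R,
    [/\ forall k, continuous (g k),
        forall k x, C x -> (f x <= (g k x)%:E)%E,
        forall x i j, (i <= j)%N -> g j x <= g i x
      & forall x, C x -> forall b : R, (f x < b%:E)%E -> exists k, g k x < b].
Proof.
move=> cptC [p Cp] fy uscf.
(* Truncating at [- k] makes [f] real-valued even where it is [-oo], and the truncation decreases as
   [k] grows. *)
pose F (k : nat) y := fine (maxe (f y) (- k%:R)%:E).
have FE k y : C y -> (F k y)%:E = maxe (f y) (- k%:R)%:E.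
  move=> /fy fyy; rewrite /F fineK// fin_numE -ltNye -ltey; apply/andP; split.
    by rewrite lt_max ltNyr orbT.
  by rewrite gt_max fyy ltry.
have Flt k y b : C y -> (F k y < b) = (f y < b%:E)%E && (- k%:R < b).
  by move=> Cy; rewrite -lte_fin FE// gt_max lte_fin.
have [c Cc Fc] : exists2 c, C c & forall y, C y -> F 0%N y <= F 0%N c.
  apply: usc_attains_max => //; first by exists p.
  move=> x Cx a; rewrite Flt// => /andP[fa a0].
  apply: filterS (uscf x Cx a fa) => y fya Cy.
  by rewrite Flt// a0 fya.
pose B := F 0%N c.
have Fmono i j y : C y -> (i <= j)%N -> F j y <= F i y.
  move=> Cy ij; rewrite -lee_fin !FE// ge_max le_max lexx/= le_max lee_fin.
  by rewrite lerN2 ler_nat ij orbT.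
have FB k y : C y -> F k y <= B.
  by move=> Cy; apply: le_trans (Fc y Cy); exact: Fmono.
pose S k x := [set F k y - k%:R * `|x - y| | y in C].
pose g k x := sup (S k x).
have kn (k : nat) (x y : 'rV[R]_n) : 0 <= k%:R * `|x - y| by rewrite mulr_ge0.
have Ssup k x : has_sup (S k x).
  split; first by exists (F k p - k%:R * `|x - p|), p.
  by exists B => _ [y Cy <-]; have := FB k y Cy; have := kn k x y; lra.
have Sle k x y : C y -> F k y - k%:R * `|x - y| <= g k x.
  by move=> Cy; apply: sup_upper_bound => //; exists y.
have gle k x b : (forall y, C y -> F k y - k%:R * `|x - y| <= b) -> g k x <= b.
  move=> yb; apply: ge_sup; first by have [] := Ssup k x.
  by move=> _ [y Cy <-]; exact: yb.
exists g; split.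
- move=> k; apply: (@lipschitz_continuous_rV _ k%:R) => x x'.
  apply: gle => y Cy; have := Sle k x' y Cy.
  have : k%:R * `|x' - y| <= k%:R * `|x - x'| + k%:R * `|x - y|.
    rewrite -mulrDr ler_wpM2l// (distrC x x') -(subrKA x x' (- y)).
    exact: ler_normD.
  by lra.
- move=> k x Cx; have := Sle k x x Cx; rewrite subrr normr0 mulr0 subr0 -lee_fin.
  by apply: le_trans; rewrite FE// le_max lexx.
- move=> x i j ij; apply: gle => y Cy; apply: le_trans (Sle i x y Cy).
  by rewrite lerB ?Fmono// ler_wpM2r// ler_nat.
- move=> x Cx b fb; have [b' fb' b'b] := lt_EFin_between fb.
  have /nbhs_ballP[d /= d0 dP] := uscf x Cx b' fb'.
  (* The first bound brings the truncation level below [b'], which settles points near [x]. The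
     second makes the penalty at distance [d] or more at least [B - b']. *)
  suff [k [kb kd]] : exists k : nat, - b' <= k%:R /\ (B - b') / d <= k%:R.
    exists k; apply: le_lt_trans b'b; apply: gle => y Cy.
    have [xyd|dxy] := ltP `|x - y| d.
      have fyb' : (f y < b'%:E)%E by apply: dP => //; rewrite mx_norm_ball.
      have : F k y <= b' by rewrite -lee_fin FE// ge_max (ltW fyb')/= lee_fin; lra.
      by have := kn k x y; lra.
    have : B - b' <= k%:R * d by rewrite -ler_pdivrMr.
    have : k%:R * d <= k%:R * `|x - y| by rewrite ler_wpM2l.
    by have := FB k y Cy; lra.
  near \oo => k; exists k; split; near: k; exact: nbhs_infty_ger.
Unshelve. all: by end_near. Qed.

End usc_approximation.

(** * Integrability on compact sets and decreasing limits *)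

Section integrals.
Context (R : realType) (n : nat).
Local Notation T := (borelRn R n).
Implicit Types (mu : probability T R) (K : set 'rV[R]_n).

Lemma bounded_measurable_integrable mu (D : set T) (f : T -> R) (M : R) :
  measurable D -> measurable_fun D f -> (forall x, D x -> `|f x| <= M) ->
  mu.-integrable D (EFin \o f).
Proof.
move=> mD mf fM; apply: measurable_bounded_integrable => //.
  by rewrite (le_lt_trans (probability_le1 mu mD))// ltry.
exists M; split; first exact: num_real.
by move=> A MA x Dx; exact: le_trans (fM x Dx) (ltW MA).
Qed.

Lemma continuous_integrable mu K (D : set 'rV[R]_n) (g : 'rV[R]_n -> R) :
  compact K -> D `<=` K -> measurable (D : set T) -> continuous g ->
  mu.-integrable (D : set T) (EFin \o g).
Proof.
move=> cptK DK mD cg; have /compact_bounded[M [_ gM]] : compact (g @` K).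
  by apply: continuous_compact => //; exact: continuous_subspaceT.
apply: (@bounded_measurable_integrable _ _ _ (M + 1)) => //.
  by apply: measurable_funTS; exact: continuous_measurable_rV.
by move=> x Dx; apply: (gM (M + 1)); [rewrite ltrDl|exists x => //; exact: DK].
Qed.

(** Monotone convergence is applied to [g 0 - g k], which increases to [g 0 - f]. For real [a] the
    lower bound on the integrals makes [g 0 - f] integrable, so the integral of [f] is recovered by
    subtraction even if [f] takes the value [-oo]. *)
Lemma le_integral_decreasing_limit mu K (f : 'rV[R]_n -> \bar R) (g : nat -> 'rV[R]_n -> R)
    (a : \bar R) :
  compact K -> measurable_fun (K : set T) (f : T -> \bar R) ->
  (forall k, continuous (g k)) -> (forall k x, K x -> (f x <= (g k x)%:E)%E) ->
  (forall x i j, (i <= j)%N -> g j x <= g i x) ->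
  (forall x, K x -> forall b : R, (f x < b%:E)%E -> exists k, g k x < b) ->
  (forall k, (a <= \int[mu]_(x in K) (g k x)%:E)%E) ->
  (a <= \int[mu]_(x in K) f x)%E.
Proof.
move=> cptK mf cg fg gmono glim ag.
have mK : measurable (K : set T).
  exact: closed_measurable_rV (compact_closed (@norm_hausdorff _ _) cptK).
have ig k : mu.-integrable (K : set T) (EFin \o g k).
  by apply: (continuous_integrable mu cptK) => //.
have Ifin k : (\int[mu]_(x in K) (g k x)%:E)%E \is a fin_num.
  exact: integrable_fin_num (ig k).
case: a ag => [a| |] ag; last by rewrite leNye.
  pose F (x : T) : \bar R := ((g 0%N x)%:E - f x)%E.
  pose G k (x : T) : \bar R := (g 0%N x - g k x)%:E.
  have mF : measurable_fun (K : set T) (F : T -> \bar R).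
    exact: (emeasurable_funB (measurable_int mu (ig 0%N)) mf).
  have F0 x : K x -> (0 <= F x)%E by move=> Kx; rewrite /F sube_ge0 ?orbT ?fg.
  have mG k : measurable_fun (K : set T) (G k : T -> \bar R).
    exact: measurable_int (integrableB mK (ig 0%N) (ig k)).
  have G0 k x : K x -> (0 <= G k x)%E by move=> _; rewrite lee_fin subr_ge0 gmono.
  have Gmono x : K x -> {homo G^~ x : i j / (i <= j)%N >-> (i <= j)%E}.
    by move=> _ i j ij; rewrite lee_fin lerB// gmono.
  have Glim x : K x -> limn (G^~ x) = F x.
    move=> Kx; apply/cvg_lim => //.
    have := ereal_nondecreasing_cvgn (Gmono x Kx); set s := ereal_sup _ => cvs.
    suff <- : s = F x by [].
    apply/eqP; rewrite eq_le; apply/andP; split.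
      apply: ge_ereal_sup => _ [k _ <-]; rewrite /G /F EFinB leeB//.
      exact: fg.
    (* If the supremum [s] were below [F x], it would be a real [r] with [f x < g 0 x - r]. Then
       some [g k x] is already below [g 0 x - r], so [G k x] exceeds [s]. *)
    rewrite leNgt; apply/negP => sF.
    have s0 : (0 <= s)%E.
      by apply: le_trans (G0 0%N x Kx) _; apply: ereal_sup_ubound; exists 0%N.
    have [r sr] : exists r, s = r%:E.
      by move: sF s0; case: s {cvs} => [r _ _| |]; [exists r|rewrite ltNge leey|].
    have : (f x < (g 0%N x - r)%:E)%E.
      move: sF; rewrite sr /F; case: (f x) (fg 0%N x Kx) => [y _| |] //=.
        by rewrite -EFinB !lte_fin; lra.
      by rewrite ltNyr.
    move=> /(glim x Kx)[k gk].
    have : (G k x <= s)%E by apply: ereal_sup_ubound; exists k.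
    by rewrite sr lee_fin; lra.
  have IF : (\int[mu]_(x in K) F x <= \int[mu]_(x in K) (g 0%N x)%:E - a%:E)%E.
    have /= := @cvg_monotone_convergence _ _ _ mu _ mK _ mG G0 Gmono.
    rewrite (eq_integral F); last by move=> x; rewrite inE => /Glim.
    move=> cvF; rewrite -(cvg_lim (@ereal_hausdorff R) cvF).
    apply: lime_le; first exact: cvgP cvF.
    apply: nearW => k; rewrite /G; under eq_integral do rewrite EFinB.
    rewrite (integralB mK (ig 0%N) (ig k)) EFinN; apply: leeB; [exact: lexx|exact: ag].
  have iF : mu.-integrable (K : set T) F.
    apply/integrableP; split => //; under eq_integral.
      by move=> x; rewrite inE => Kx; rewrite gee0_abs ?F0//; over.
    apply: le_lt_trans IF _; rewrite lte_add_pinfty ?ltry//.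
    by rewrite ltey_eq Ifin.
  have -> : (\int[mu]_(x in K) f x = \int[mu]_(x in K) ((g 0%N x)%:E - F x))%E.
    apply: eq_integral => x _; rewrite /F.
    case: (f x) => [y||] //.
    by apply: (congr1 EFin (_ : y = g 0%N x - (g 0%N x - y))); lra.
  rewrite (integralB mK (ig 0%N) iF); move: IF.
  have := integrable_fin_num mK iF.
  case: (\int[mu]_(x in K) F x)%E => // b _; move: (Ifin 0%N).
  case: (\int[mu]_(x in K) (g 0%N x)%:E)%E => // c _.
  by rewrite -!EFinB !lee_fin; lra.
(* The value [a = +oo] is excluded because the integral of [g 0] is finite. *)
by have := ag 0%N; rewrite leye_eq => /eqP I; have := Ifin 0%N; rewrite I.
Qed.

End integrals.

Theorem harmonic_measure_jensen (R : realType) (n : nat) (n_gt0 : (0 < n)%N)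
    (K : set 'rV[R]_n) (cptK : compact K) (z : 'rV[R]_n) (Kz : K z)
    (omega : probability (borelRn R n) R) :
  harmonic_measure_compact K z omega -> jensen_at K z omega.
Proof.
move=> [U [omega_ [KU hm wcv]]] V oV KV.
have clK : closed K by apply: compact_closed => //; exact: norm_hausdorff.
have null := harmonic_measure_compact_null clK KU hm wcv.
have sK := msupport_subset clK null.
split; first by apply: subclosed_compact cptK sK; exact: msupport_closed.
  exact: subset_trans KV.
move=> f shf; have [fy uscf _] := shf.
have mK := closed_measurable_rV clK; have mV := open_measurable_rV oV.
have mf := usc_measurable oV uscf.
have [j0 /(_ j0 (leqnn _)) UV] := regular_seq_sub clK KU oV KV.
have KUj : K `<=` closure (U j0).
  by have [_ KUj _ _] := KU => x /(KUj j0); exact: subset_closure.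
(* The approximation takes place on [closure (U j0)] rather than on [K], since [f] is compared with
   the Dirichlet data on the boundaries of the [U j], which are disjoint from [K]. *)
have [g [cg fg gmono glim]] : exists g : nat -> 'rV[R]_n -> R,
    [/\ forall k, continuous (g k),
        forall k x, closure (U j0) x -> (f x <= (g k x)%:E)%E,
        forall x i j, (i <= j)%N -> g j x <= g i x
      & forall x, closure (U j0) x -> forall b : R, (f x < b%:E)%E -> exists k, g k x < b].
  apply: usc_approximation.
  - exact: regular_seq_compact KU _.
  - by exists z; exact: KUj.
  - by move=> x /UV /fy.
  - by move=> x /UV Vx a fa; apply: filterS (uscf x Vx a fa).
rewrite (integral_full_subset mK mV KV _ mf); last first.
  apply/eqP; rewrite eq_le measure_ge0 andbT -null le_measure ?inE//.
  - exact: measurableD.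
  - exact: measurableC.
have mfK := measurable_funS mV KV mf.
have fgK k x : K x -> (f x <= (g k x)%:E)%E by move=> /KUj; exact: fg.
have glimK x (Kx : K x) := glim x (KUj x Kx).
apply: (le_integral_decreasing_limit cptK mfK cg fgK gmono glimK) => k.
exact: (le_harmonic_measure_integral clK KU Kz hm wcv n_gt0 UV shf (cg k) (fg k)).
Qed.

(** * Maximality *)

Section continuous_subharmonic.
Context (R : realType) (n : nat) (n_gt0 : (0 < n)%N).
Local Notation T := (borelRn R n).

(** These test functions belong to [SK K] for every [K], and their differences suffice to determine
    a measure. *)
Definition csubharmonic (phi : 'rV[R]_n -> R) : Prop :=
  continuous phi /\ subharmonic setT (EFin \o phi).

Lemma csubharmonic_affine a b : csubharmonic (affine a b).
Proof.
by split; [exact: affine_continuous|apply: subharmonic_affine => //; exact: openT].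
Qed.

Lemma csubharmonic_max f g : csubharmonic f -> csubharmonic g ->
  csubharmonic (fun x => Num.max (f x) (g x)).
Proof.
by move=> [cf sf] [cg sg]; split; [exact: continuous_maxr|exact: subharmonic_max].
Qed.

Lemma csubharmonic_scale f a b : 0 < a -> csubharmonic f ->
  csubharmonic (fun x => a * f x + b).
Proof.
move=> a0 [cf sf]; split; last exact: subharmonic_scale.
by move=> x; exact: (cvgD (cvgM (cvg_cst a) (cf x)) (cvg_cst b)).
Qed.

Lemma csubharmonic_normB c b : csubharmonic (fun x => `|x - c| + b).
Proof.
have -> : (fun x => `|x - c| + b) = (fun x : 'rV[R]_n => 1 * `|x - c| + b).
  by apply/funext => x; rewrite mul1r.
apply: csubharmonic_scale => //; split; first exact: continuous_normB.
by apply: subharmonic_normB => //; exact: openT.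
Qed.

Lemma csubharmonic_cst (c : R) : csubharmonic (cst c).
Proof.
have -> : cst c = affine (0 : 'rV[R]_n) c; last exact: csubharmonic_affine.
apply/funext => x; rewrite /affine /dot big1 ?add0r// => i _.
by rewrite mxE mul0r.
Qed.

Lemma csubharmonic_SK K phi : csubharmonic phi -> SK K phi.
Proof.
move=> [cphi sphi]; have cK : {within K, continuous phi} by exact: continuous_subspaceT.
split => // e e0; exists phi; last by move=> x _; rewrite subrr normr0.
by split => //; exists setT, (EFin \o phi); split => //; exact: openT.
Qed.

Section sublevel_sets.
Context (mu nu : probability T R) (K : set 'rV[R]_n).
Hypotheses (cptK : compact K) (muK : mu (~` K) = 0%E) (nuK : nu (~` K) = 0%E).
Hypothesis munu : forall phi, csubharmonic phi ->
  (\int[mu]_(x in K) (phi x)%:E = \int[nu]_(x in K) (phi x)%:E)%E.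

Let mK : measurable (K : set T).
Proof. exact: closed_measurable_rV (compact_closed (@norm_hausdorff _ _) cptK). Qed.

(* soft m k = 1 + max(k m, 0) - max(k m + 1, 0), with k shifted by one; the
   superfluous [1 *] and [+ 0] match the shape of csubharmonic_scale. *)
Let soft (m : 'rV[R]_n -> R) (k : nat) (x : 'rV[R]_n) : R :=
  (1 * Num.max (k.+1%:R * m x + 0) 0 + 1) - Num.max (k.+1%:R * m x + 1) 0.

(** Where [m x >= 0], both maxima are reached by their affine terms, which cancel exactly. *)
Let softE m k x : soft m k x =
  if m x < 0 then 1 - Num.max (k.+1%:R * m x + 1) 0 else 0.
Proof.
rewrite /soft; have k0 : (0 : R) < k.+1%:R by rewrite ltr0n.
case: ltP => mx.
  rewrite (@max_idPr _ _ (k.+1%:R * m x + 0) 0 _) ?mulr0 ?add0r//.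
  by rewrite addr0 nmulr_lle0// ltW.
have km : 0 <= k.+1%:R * m x by rewrite mulr_ge0// ltW.
rewrite (@max_idPl _ _ (k.+1%:R * m x + 0) 0 _) ?addr0//.
by rewrite (@max_idPl _ _ (k.+1%:R * m x + 1) 0 _); lra.
Qed.

Let soft_csubharmonic1 m k : csubharmonic m ->
  csubharmonic (fun x => 1 * Num.max (k.+1%:R * m x + 0) 0 + 1).
Proof.
move=> cm; apply: csubharmonic_scale => //.
by apply: csubharmonic_max; [exact: csubharmonic_scale|exact: csubharmonic_cst].
Qed.

Let soft_csubharmonic2 m k : csubharmonic m -> csubharmonic (fun x => Num.max (k.+1%:R * m x + 1) 0).
Proof.
by move=> cm; apply: csubharmonic_max; [exact: csubharmonic_scale|exact: csubharmonic_cst].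
Qed.

Let soft_continuous m k : csubharmonic m -> continuous (soft m k).
Proof.
by move=> cm x; exact: (cvgB ((soft_csubharmonic1 k cm).1 x) ((soft_csubharmonic2 k cm).1 x)).
Qed.

(** Restricting to the compact [K] makes both terms integrable, so the integral of the difference
    splits. *)
Let soft_integral (la : probability T R) m k : la (~` K) = 0%E -> csubharmonic m ->
  (\int[la]_x (soft m k x)%:E =
   \int[la]_(x in K) (1 * Num.max (k.+1%:R * m x + 0) 0 + 1)%:E -
   \int[la]_(x in K) (Num.max (k.+1%:R * m x + 1) 0)%:E)%E.
Proof.
move=> laK cm; have [c1 _] := soft_csubharmonic1 k cm; have [c2 _] := soft_csubharmonic2 k cm.
rewrite (@integral_full_subset _ _ _ la K setT)//.
- have i1 := continuous_integrable la cptK (@subset_refl _ K) mK c1.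
  have i2 := continuous_integrable la cptK (@subset_refl _ K) mK c2.
  by rewrite -(integralB mK i1 i2); apply: eq_integral.
- by rewrite setTD.
- by apply/measurable_EFinP; apply: continuous_measurable_rV; exact: soft_continuous.
Qed.

Let soft_cvg (la : probability T R) m : csubharmonic m ->
  (\int[la]_x (soft m k x)%:E)%E @[k --> \oo] --> la [set x | m x < 0].
Proof.
move=> cshm; have [cm _] := cshm; pose A : set T := [set x | m x < 0].
have mA : measurable A.
  apply: open_measurable_rV; rewrite (_ : A = m @^-1` [set t | t < 0])//.
  by apply: open_comp; [move=> x _; exact: cm|exact: open_lt].
have soft_ge0 k x : 0 <= soft m k x.
  rewrite softE; case: ifPn => // mx; rewrite subr_ge0 ge_max ler01 andbT.
  by rewrite gerDr nmulr_lle0.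
have soft_mono x i j : (i <= j)%N -> soft m i x <= soft m j x.
  move=> ij; rewrite !softE; case: ifPn => // mx; rewrite lerB// ge_max !le_max lexx orbT andbT.
  by apply/orP; left; rewrite lerD2r ler_wnM2r ?ler_nat// ltW.
have ms k : measurable_fun [set: T] (EFin \o soft m k : T -> \bar R).
  by apply/measurable_EFinP; apply: continuous_measurable_rV; exact: soft_continuous.
have lim_soft (x : T) : limn (fun k => (soft m k x)%:E) = (\1_A x)%:E.
  apply/cvg_lim => //; apply: cvg_near_cst.
  rewrite indicE; have [xA|xA] := boolP (x \in A).
    move: xA; rewrite inE /A/= => mx; near=> k.
    (* Once [k] reaches [- (m x)^-1], the remaining maximum is 0 and the sequence stays equal to
       1. *)
    rewrite softE mx (max_idPr _) ?subr0//.
    have : - (m x)^-1 <= k%:R by near: k; exact: nbhs_infty_ger.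
    rewrite -(ler_nM2r mx) mulNr mulVf ?lt_eqF// -[k.+1%:R]natr1; lra.
  apply: nearW => k; rewrite softE ifF//; apply/negbTE.
  by move: xA; rewrite notin_setE /A/= => /negP.
have := @cvg_monotone_convergence _ _ _ la setT measurableT (fun k x => (soft m k x)%:E) ms.
rewrite (eq_integral (EFin \o \1_A)); last by move=> x _; rewrite lim_soft.
rewrite integral_indic// setIT; apply.
  by move=> k x _; rewrite lee_fin.
by move=> x _ i j ij; rewrite lee_fin soft_mono.
Unshelve. all: by end_near. Qed.

Lemma sublevel_measure_eq m : csubharmonic m -> mu [set x | m x < 0] = nu [set x | m x < 0].
Proof.
move=> cm; have cmu := @soft_cvg mu _ cm; have cnu := @soft_cvg nu _ cm.
rewrite -(cvg_lim (@ereal_hausdorff R) cmu) -(cvg_lim (@ereal_hausdorff R) cnu).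
congr (lim (_ @ \oo)); apply/funext => k; rewrite !soft_integral//.
by congr (_ - _)%E; apply: munu; [exact: soft_csubharmonic1|exact: soft_csubharmonic2].
Qed.

Lemma csubharmonic_meas_eq : meas_eq mu nu.
Proof.
pose G : set (set T) := [set A | exists2 m, csubharmonic m & A = [set x | m x < 0]].
have GT : G setT.
  exists (cst (-1)); first exact: csubharmonic_cst.
  by apply/seteqP; split => x //= _; rewrite ltrN10.
have Gm : G `<=` measurable.
  move=> A [m [cm _] ->]; apply: open_measurable_rV.
  rewrite (_ : [set x | m x < 0] = m @^-1` [set t | t < 0])//.
  by apply: open_comp; [move=> x _; exact: cm|exact: open_lt].
(* An open set is a countable union of base balls, each of which is the sublevel set of some
   [|x - c| - r]. *)
have openG : @open 'rV[R]_n `<=` <<s G >>.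
  move=> V oV; have [B [Bball Bbase]] := countable_nball_base R n.
  have -> : V = \bigcup_k (if `[< B k `<=` V >] then B k else set0).
    apply/seteqP; split => [x Vx|x [k _]].
      by have [k [Bx BV]] := Bbase V x oV Vx; exists k => //; rewrite (asboolT BV).
    by case: asboolP => // BV /BV.
  apply: sigma_algebra_bigcup => k.
  case: asboolP => _; last exact: sigma_algebra0.
  apply: sub_sigma_algebra; have [c [r ->]] := Bball k.
  exists (fun x => `|x - c| + - r); first exact: csubharmonic_normB.
  by apply/seteqP; split => x; rewrite /nball/= subr_lt0.
(* The whole space belongs to [G] and serves as a constant exhaustion; intersections in [G] come
   from maxima of the defining functions. *)
move=> A mA; apply: (@g_sigma_algebra_measure_unique _ _ _ G Gm (fun=> setT)) => //.
- by rewrite bigcup_const.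
- move=> _ _ [m1 cm1 ->] [m2 cm2 ->]; exists (fun x => Num.max (m1 x) (m2 x)).
    exact: csubharmonic_max.
  by apply/seteqP; split => x /=; rewrite gt_max => /andP.
- by move=> _ [m cm ->]; exact: sublevel_measure_eq.
- by move=> _; rewrite (le_lt_trans (probability_le1 mu measurableT))// ltry.
- by apply: smallest_sub mA => //; exact: smallest_sigma_algebra.
Qed.

End sublevel_sets.

End continuous_subharmonic.

(** * Comparison of Jensen measures with harmonic measure *)

Section maximality.
Context (R : realType) (n : nat) (n_gt0 : (0 < n)%N) (K : set 'rV[R]_n).
Hypothesis cptK : compact K.
Local Notation T := (borelRn R n).

Let clK : closed K.
Proof. exact: compact_closed (@norm_hausdorff _ _) cptK. Qed.

Let mK : measurable (K : set T).
Proof. exact: closed_measurable_rV clK. Qed.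

(** For [x] outside [K], the complement of [x] is an open neighbourhood of [K], so the support must
    avoid [x]. *)
Lemma jensen_at_null w (nu : probability T R) : jensen_at K w nu -> nu (~` K) = 0%E.
Proof.
move=> jnu; apply: msupport_null; first exact: closed_openC.
move=> x nKx suppx; have oU : open (~` [set x]).
  by apply: closed_openC; apply: compact_closed; [exact: norm_hausdorff|exact: compact_set1].
have KU : K `<=` ~` [set x] by move=> y Ky /= yx; apply: nKx; rewrite -yx.
by have [_ /(_ x suppx) /= + _] := jnu _ oU KU; apply.
Qed.

(** The whole space serves as the neighbourhood of [K], and the integral is then restricted to [K],
    which carries [nu]. *)
Lemma jensen_le_csh w (nu : probability T R) phi : jensen_at K w nu -> csubharmonic phi ->
  ((phi w)%:E <= \int[nu]_(x in K) (phi x)%:E)%E.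
Proof.
move=> jnu [cphi sphi]; have [_ _ /(_ _ sphi) /=] := jnu _ openT (@subsetT _ K).
have mphi : measurable_fun [set: T] (EFin \o phi : T -> \bar R).
  by apply/measurable_EFinP; exact: continuous_measurable_rV.
have nuK : nu (setT `\` K) = 0%E by rewrite setTD (jensen_at_null jnu).
by rewrite (integral_full_subset mK measurableT (@subsetT _ K) nuK mphi).
Qed.

(** Both the affine function and its opposite are subharmonic, so the Jensen inequality holds in
    both directions. *)
Lemma jensen_affine w (nu : probability T R) a : jensen_at K w nu ->
  (\int[nu]_(x in K) (affine a 0 x)%:E = (affine a 0 w)%:E)%E.
Proof.
move=> jnu; have aN (x : 'rV[R]_n) : affine (- a) 0 x = - affine a 0 x.
  by rewrite /affine -scaleN1r dotC dotZr dotC !addr0 mulN1r.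
have le1 := jensen_le_csh jnu (csubharmonic_affine n_gt0 (- a) 0).
apply/eqP; rewrite eq_le (jensen_le_csh jnu (csubharmonic_affine n_gt0 a 0)) andbT.
have ia := continuous_integrable nu cptK (@subset_refl _ K) mK (@affine_continuous R n a 0).
move: le1; rewrite aN (eq_integral (fun x : T => - (affine a 0 x)%:E)%E); last first.
  by move=> x _; rewrite aN.
rewrite integralN/=; last exact: integrable_add_def ia.
by rewrite EFinN leeN2.
Qed.

(** The maximum principle gives [phi <= h] on [U], and the Jensen inequality for the subharmonic
    function [- h] bounds the integral of [h] by [h w]. *)
Lemma jensen_le_dirichlet w (nu : probability T R) (U : set 'rV[R]_n)
    (phi h : 'rV[R]_n -> R) :
  jensen_at K w nu -> csubharmonic phi -> open U -> compact (closure U) -> K `<=` U ->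
  dirichlet_solution U phi h -> (\int[nu]_(x in K) (phi x)%:E <= (h w)%:E)%E.
Proof.
move=> jnu [cphi sphi] oU cptU KU [ch hh hb]; have mU := open_measurable_rV oU.
have phi_le y : U y -> phi y <= h y.
  move=> /subset_closure Uy; rewrite -lee_fin.
  apply: (subharmonic_le_harmonic n_gt0 oU cptU (@subsetT _ _) sphi ch hh) => //.
  by move=> x /hb ->.
have hN : harmonic_on U (fun x => - h x).
  have := harmonic_on_lin (-1) oU (harmonic_affine U 0 0) hh.
  by congr (harmonic_on U _); apply/funext => x;
    rewrite /affine -(scale0r (0 : 'rV[R]_n)) dotC dotZr; ring.
have sN := harmonic_subharmonic n_gt0 oU hN; have [_ uN _] := sN.
have [_ _ /(_ _ sN)] := jnu U oU KU.
have /compact_bounded[M [_ hM]] : compact (h @` closure U) by exact: continuous_compact.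
have iN : nu.-integrable (U : set T) (EFin \o (fun x => - h x)).
  apply: (@bounded_measurable_integrable _ _ _ _ _ (M + 1)) => //.
    by apply/measurable_EFinP; exact: usc_measurable.
  move=> x Ux; rewrite normrN; apply: (hM (M + 1)); first by rewrite ltrDl.
  by exists x => //; exact: subset_closure.
have cphiN : continuous (fun x => - phi x) by move=> x; exact: (cvgN (cphi x)).
have iphiN := continuous_integrable nu cptU (@subset_closure _ U) mU cphiN.
have iphi := continuous_integrable nu cptK (@subset_refl _ K) mK cphi.
have nuUK : nu (U `\` K) = 0%E.
  apply/eqP; rewrite eq_le measure_ge0 andbT -(jensen_at_null jnu) le_measure ?inE//.
  - exact: measurableD.
  - exact: measurableC.
move=> hw; have : (- (h w)%:E <= - \int[nu]_(x in K) (phi x)%:E)%E.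
  rewrite -integralN/=; last exact: integrable_add_def iphi.
  apply: le_trans hw _.
  rewrite -(integral_full_subset mK mU KU nuUK (measurable_int nu iphiN)).
  apply: le_integral => // x; rewrite inE => Ux.
  by rewrite lee_fin lerN2 phi_le.
by rewrite leeN2.
Qed.

Lemma jensen_le_harmonic_measure z (nu omega : probability T R) phi : K z ->
  harmonic_measure_compact K z omega -> jensen_at K z nu -> csubharmonic phi ->
  (\int[nu]_(x in K) (phi x)%:E <= \int[omega]_(x in K) (phi x)%:E)%E.
Proof.
move=> Kz [U [omega_ [KU hm wcv]]] jnu cshphi; have [cphi _] := cshphi.
have cvI := harmonic_measure_cvg clK KU hm wcv cphi.
rewrite -(cvg_lim (@ereal_hausdorff R) cvI); apply: lime_ge; first exact: cvgP cvI.
apply: nearW => j; have [Ureg KUj _ _] := KU.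
have cb : {within bdry (U j), continuous phi} by exact: continuous_subspaceT.
have [oU _ /(_ phi cb)[h hsol]] := Ureg j; have [_ /(_ phi h cb hsol) <-] := hm j.
exact: jensen_le_dirichlet jnu cshphi oU (@regular_seq_compact _ _ _ _ KU j) (KUj j) hsol.
Qed.

End maximality.

Theorem theorem4p7 (R : realType) (n : nat) (n_ge2 : (2 <= n)%N)
    (K : set 'rV[R]_n) (cptK : compact K) (z : 'rV[R]_n) (Kz : K z)
    (omega : probability (borelRn R n) R)
    (omegaP : harmonic_measure_compact K z omega) :
  maximal_jensen K omega.
Proof.
have n_gt0 : (0 < n)%N by exact: ltnW.
have jomega := harmonic_measure_jensen n_gt0 cptK Kz omegaP.
split; first by exists z.
move=> [nu [[w Kw jnu] nu_omega nu_neq]].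
(* Testing the order against each coordinate function and its opposite forces the two base points to
   have equal coordinates. *)
have wz : w = z.
  have leN a : affine a 0 z <= affine a 0 w.
    have := nu_omega _ (csubharmonic_SK K (csubharmonic_affine n_gt0 a 0)).
    by rewrite (jensen_affine n_gt0 cptK a jnu) (jensen_affine n_gt0 cptK a jomega) lee_fin.
  apply/rowP => i; have := leN (basis_vec R i); have := leN ((-1) *: basis_vec R i).
  by rewrite /affine !(dotC _ w) !(dotC _ z) !dotZr !dot_basis_vec; lra.
rewrite wz in jnu; apply: nu_neq.
have [nuK omegaK] := (jensen_at_null cptK jnu, jensen_at_null cptK jomega).
apply: (csubharmonic_meas_eq n_gt0 cptK nuK omegaK) => phi cphi.
(* Comparison with the Dirichlet solutions gives one inequality, now that the base points agree; the
   assumed order gives the other. *)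
apply/eqP; rewrite eq_le (jensen_le_harmonic_measure n_gt0 cptK Kz omegaP jnu cphi).
exact: nu_omega (csubharmonic_SK K cphi).
Qed.
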